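(* Let $f\in C^d(\overline S)$ be a probability density and let $\varphi\in L^\infty(S)$. For every nonempty $I\subseteq[d]$, define $$\mathfrak B_{\mathrm{TV},I}(\varphi;f):=\frac1{2|I|}\Lambda_{\mathrm{sl}}^I(\mathcal P_I\varphi)\,\mathrm{TV}_I(f;S),$$ $$\mathfrak B_{\mathrm{mix},I}(\varphi;f):=2^{-|I|}\Lambda_{\mathrm{mix}}^I(\mathcal P_I\varphi)\int_S|\partial_If(\omega)|\,d\omega,$$ and $$\Delta_I(\varphi):=\|\mathcal R_I\varphi\|_{L^\infty(S)}.$$ Then $$|\mathbb E_f[\varphi]|\le\min_{\emptyset\ne I\subseteq[d]}\Bigl\{\Delta_I(\varphi)+\min\bigl\{\mathfrak B_{\mathrm{TV},I}(\varphi;f),\mathfrak B_{\mathrm{mix},I}(\varphi;f)\bigr\}\Bigr\}.$$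
   Context: Let $d\ge 1$, $[d]=\{1,\dots,d\}$, and let $S=\prod_{i=1}^d[a_i,b_i]\subset\mathbb R^d$ be a box with $a_i<b_i$. For $I\subseteq[d]$ write $\omega_I=(\omega_i)_{i\in I}$, $\omega_{-I}=(\omega_j)_{j\notin I}$, $S_I=\prod_{i\in I}[a_i,b_i]$, $S_{-I}=\prod_{j\notin I}[a_j,b_j]$ (a singleton if $I=[d]$), and $-i$ for $-\{i\}$. A probability density on $S$ is a nonnegative integrable function with integral $1$; $\mathbb E_f[\varphi]=\int_S\varphi f\,d\omega$. Projectors: $(\Pi_i\varphi)(\omega)=\frac1{b_i-a_i}\int_{a_i}^{b_i}\varphi(\omega_{-i},t)\,dt$ ($t$ inserted in coordinate $i$); these operators commute. $\mathcal P_I=\prod_{i\in I}(\mathrm{Id}-\Pi_i)$, $\mathcal R_I=\mathrm{Id}-\mathcal P_I$. Envelopes: $$\Lambda_{\mathrm{sl}}^I(\varphi)=\max_{i\in I}\operatorname*{ess\,sup}_{\omega_{-i}\in S_{-i}}\int_{a_i}^{b_i}|\varphi(\omega_{-i},t)|\,dt,\qquad \Lambda_{\mathrm{mix}}^I(\varphi)=\operatorname*{ess\,sup}_{\omega_{-I}\in S_{-I}}\int_{S_I}|\varphi(\omega_{-I},t_I)|\,dt_I.$$ Variation: $D_if$ is the $i$th distributional derivative measure on the interior of $S$, $|D_if|(S)$ its total variation mass there, and $\mathrm{TV}_I(f;S)=\sum_{i\in I}|D_if|(S)$. For $I=\{i_1<\cdots<i_k\}$, $\partial_If=\partial_{i_1}\cdots\partial_{i_k}f$.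 $C^d(\overline S)$ denotes functions $C^d$ up to the boundary of $S$. *)

(* Defs.v *)
From HB Require Import structures.
From mathcomp Require Import all_boot all_order all_algebra.
From mathcomp Require Import all_classical all_reals all_analysis.
From mathcomp Require Import ess_sup_inf.

Set Implicit Arguments.
Unset Strict Implicit.
Unset Printing Implicit Defensive.

Import Order.TTheory GRing.Theory Num.Theory.
Import numFieldNormedType.Exports.

Local Open Scope classical_set_scope.
Local Open Scope ring_scope.

(** R^n is ['rV[R]_n], with the sigma-algebra generated by the coordinates,
    i.e. the Borel sets. *)

Definition measure_rV_display : measure_display -> measure_display.
Proof. exact. Qed.

Section measurable_rV.
Context {disp : measure_display} {T : measurableType disp}.
Variable n : nat.

Let coors : 'I_n -> 'rV[T]_n -> T := fun i x => x ord0 i.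

Let rV_set0 : g_sigma_preimage coors set0.
Proof. exact: sigma_algebra0. Qed.

Let rV_setC A : g_sigma_preimage coors A -> g_sigma_preimage coors (~` A).
Proof. exact: sigma_algebraC. Qed.

Let rV_bigcup (F : (set 'rV[T]_n)^nat) :
  (forall i, g_sigma_preimage coors (F i)) ->
  g_sigma_preimage coors (\bigcup_i (F i)).
Proof. exact: sigma_algebra_bigcup. Qed.

HB.instance Definition _ := @isMeasurable.Build (measure_rV_display disp)
  'rV[T]_n (g_sigma_preimage coors) rV_set0 rV_setC rV_bigcup.

Lemma measurable_coord (i : 'I_n) :
  measurable_fun [set: 'rV[T]_n] (fun x : 'rV[T]_n => x ord0 i).
Proof.
move=> _ Y mY; rewrite setTI; apply: sub_sigma_algebra => /=.
rewrite -bigcup_seq/=; exists i; first by rewrite /= mem_index_enum.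
by exists Y => //; rewrite setTI.
Qed.

Lemma measurable_fun_coord d1 (U : measurableType d1) (g : U -> 'rV[T]_n) :
  (forall i, measurable_fun [set: U] (fun u => g u ord0 i)) ->
  measurable_fun [set: U] g.
Proof.
move=> mg _ A mA.
suff : <<s \big[setU/set0]_(i < n)
    preimage_set_system setT (coors i) measurable >> `<=`
    [set B | measurable ([set: U] `&` g @^-1` B)] by apply.
apply: smallest_sub.
  split=> /=; first by rewrite preimage_set0 setI0.
    move=> B /=; rewrite !setTI setTD -preimage_setC => mB.
    exact: measurableC.
  move=> F mF; rewrite preimage_bigcup setI_bigcupr.
  exact: bigcupT_measurable.
move=> B; rewrite -bigcup_seq => -[i _ [Y mY <-]] /=.
by rewrite [X in g @^-1` X]setTI; apply: (mg i measurableT).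
Qed.

End measurable_rV.

(** The n-dimensional Lebesgue measure: on R^0 the unit mass, on R^(1+n) the
    image of the product of the Lebesgue measures of R and R^n under the
    concatenation (t, x) |-> row_mx t x. *)

Section lebesgue_rV.
Context {R : realType}.

Definition rV_cons n (p : measurableTypeR R * 'rV[R]_n) : 'rV[R]_(1 + n) :=
  row_mx (const_mx p.1) p.2.

Definition rV_uncons n (x : 'rV[R]_(1 + n)) : measurableTypeR R * 'rV[R]_n :=
  (x ord0 (lshift n ord0), rsubmx x).

Lemma rV_consK n : cancel (@rV_cons n) (@rV_uncons n).
Proof.
by move=> [t x]; rewrite /rV_uncons/rV_cons row_mxEl mxE row_mxKr.
Qed.

Lemma measurable_rV_cons n : measurable_fun setT (@rV_cons n).
Proof.
apply: measurable_fun_coord => i; rewrite /rV_cons.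
case: (split_ordP i) => j ->.
  by under eq_fun do rewrite row_mxEl mxE; exact: measurable_fst.
under eq_fun do rewrite row_mxEr.
exact: (measurableT_comp (measurable_coord j) measurable_snd).
Qed.

Lemma measurable_rV_uncons n : measurable_fun setT (@rV_uncons n).
Proof.
apply/measurable_fun_pairP; split; first exact: measurable_coord.
apply: measurable_fun_coord => i /=.
by under eq_fun do rewrite mxE; exact: measurable_coord.
Qed.

Section step.
Variables (n : nat) (m : {sigma_finite_measure set 'rV[R]_n -> \bar R}).

Definition lebesgue_rV_step : set 'rV[R]_(1 + n) -> \bar R :=
  pushforward (lebesgue_measure \x m)%E (@rV_cons n).

Let step : {measure set 'rV[R]_(1 + n) -> \bar R} :=
  measure_function_pushforward__canonical__measure_function_Measure
    (lebesgue_measure \x m)%E (@measurable_rV_cons n).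

HB.instance Definition _ := Measure.copy lebesgue_rV_step step.

Let step_sigma_finite : sigma_finite setT lebesgue_rV_step.
Proof.
have /sigma_finiteP[F [UF ndF mF]] := sigma_finiteT (@lebesgue_measure R).
have /sigma_finiteP[G [UG ndG mG]] := sigma_finiteT m.
exists (fun k => @rV_uncons n @^-1` (F k `*` G k)).
  apply/esym/seteqP; split => // x _.
  have [i _ Fi] : (\bigcup_k F k) (rV_uncons x).1 by rewrite -UF.
  have [j _ Gj] : (\bigcup_k G k) (rV_uncons x).2 by rewrite -UG.
  exists (maxn i j) => //; split.
    by move: Fi; apply/subsetPset/ndF/leq_maxl.
  by move: Gj; apply/subsetPset/ndG/leq_maxr.
move=> k; have [mFk Fk] := mF k; have [mGk Gk] := mG k; split.
  rewrite -[X in measurable X]setTI; apply: measurable_rV_uncons => //.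
  exact: measurableX.
rewrite /lebesgue_rV_step /pushforward -comp_preimage.
rewrite (_ : _ \o _ = id) ?preimage_id; last first.
  by apply/funext => x /=; rewrite rV_consK.
by rewrite product_measure1E// lte_mul_pinfty// ge0_fin_numE.
Qed.

HB.instance Definition _ :=
  Measure_isSigmaFinite.Build _ _ _ lebesgue_rV_step step_sigma_finite.

End step.

Fixpoint lebesgue_rV n : {sigma_finite_measure set 'rV[R]_n -> \bar R} :=
  if n is n'.+1 then lebesgue_rV_step (lebesgue_rV n') else \d_(0 : 'rV[R]_0).

End lebesgue_rV.

Section box.
Context {R : realType}.

Definition box n (a b : 'rV[R]_n) : set 'rV[R]_n :=
  [set x | forall i, a ord0 i <= x ord0 i <= b ord0 i].

Lemma measurable_box n (a b : 'rV[R]_n) : measurable (box a b).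
Proof.
rewrite [X in measurable X](_ : _ =
    \big[setI/setT]_(i < n) ((fun x : 'rV[R]_n => x ord0 i) @^-1`
      `[a ord0 i, b ord0 i])).
  apply: bigsetI_measurable => i _; rewrite -[X in measurable X]setTI.
  exact: measurable_coord.
rewrite -bigcap_seq; apply/seteqP; split=> [x abx i _ /=|x abx i].
  by rewrite in_itv/= abx.
by have := abx i (mem_index_enum i); rewrite /= in_itv.
Qed.

(** Lebesgue measure on the box; essential suprema over the box refer to it. *)
Definition lebesgue_box n (a b : 'rV[R]_n) : {measure set 'rV[R]_n -> \bar R} :=
  mrestr (lebesgue_rV n) (measurable_box a b).

End box.

Section coordinates.
Context {R : realType} {d : nat}.
Implicit Types (x : 'rV[R]_d) (i : 'I_d) (I : {set 'I_d}).

Definition set_coord x i (t : R) : 'rV[R]_d :=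
  \row_j (if j == i then t else x ord0 j).

(** Points of R^I are ['rV_#|I|], coordinates listed in increasing order. *)

Definition restr_coord I x : 'rV[R]_#|I| := \row_k x ord0 (enum_val k).

Definition coord_at I (v : 'rV[R]_#|I|) i : R :=
  if [pick k | enum_val k == i] is Some k then v ord0 k else 0.

(** [glue_coord u t] is the point (omega_{-I}, t_I) with [u] = omega_{-I}. *)
Definition glue_coord I (u : 'rV[R]_#|~: I|) (t : 'rV[R]_#|I|) : 'rV[R]_d :=
  \row_i (if i \in I then coord_at t i else coord_at u i).

End coordinates.

Section projectors_envelopes.
Context {R : realType} {d : nat}.
Variables (a b : 'rV[R]_d).
Implicit Types (phi : 'rV[R]_d -> R) (i : 'I_d) (I : {set 'I_d}).

(** Elements of L^oo(S) are represented by functions on R^d, of which only the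
    values on S matter, and these only up to a null set. *)
Definition Linfty phi : Prop :=
  measurable_fun (box a b) phi /\ finite_norm (lebesgue_box a b) +oo%E phi.

Definition Linfty_norm phi : \bar R :=
  'N[lebesgue_box a b]_+oo%E[EFin \o phi]%E.

Definition Pi_ i phi : 'rV[R]_d -> R := fun x =>
  (b ord0 i - a ord0 i)^-1 *
  \int[lebesgue_measure]_(t in `[a ord0 i, b ord0 i]) phi (set_coord x i t).

Definition P_ I phi : 'rV[R]_d -> R :=
  foldr (fun i psi => psi \- Pi_ i psi) phi (enum I).

Definition R_ I phi : 'rV[R]_d -> R := phi \- P_ I phi.

Local Open Scope ereal_scope.

Definition Lambda_sl I phi : \bar R :=
  \big[maxe/-oo]_(i in I)
    ess_sup (lebesgue_box (restr_coord (~: [set i]) a)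
                          (restr_coord (~: [set i]) b))
      (fun u => \int[lebesgue_measure]_(t in `[a ord0 i, b ord0 i])
         `|phi (@glue_coord _ _ [set i] u (const_mx t))|%:E).

Definition Lambda_mix I phi : \bar R :=
  ess_sup (lebesgue_box (restr_coord (~: I) a) (restr_coord (~: I) b))
    (fun u => \int[lebesgue_rV #|I|]_(t in box (restr_coord I a) (restr_coord I b))
       `|phi (glue_coord u t)|%:E).

End projectors_envelopes.

Section derivatives.
Context {R : realType} {d : nat}.
Implicit Types (f psi : 'rV[R]_d -> R) (i : 'I_d) (s : seq 'I_d).

Definition pd i f : 'rV[R]_d -> R := 'D_(delta_mx ord0 i) f.

(** [pds [:: i_1; ...; i_k] f] is d_{i_1} ... d_{i_k} f. *)
Definition pds s f : 'rV[R]_d -> R := foldr pd f s.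

(** C^k up to the boundary of the closed box: f is continuous on S, is C^k in
    the interior, and its partial derivatives of order at most k extend
    continuously to S. *)
Definition Ck_closure k (S : set 'rV[R]_d) f : Prop :=
  [/\ {within S, continuous f},
      forall s, (size s < k)%N ->
        forall i x, S° x -> derivable (pds s f) x (delta_mx ord0 i) &
      forall s, (size s <= k)%N ->
        exists g : 'rV[R]_d -> R,
          {within S, continuous g} /\ forall x, S° x -> pds s f x = g x].

(** Test functions in C_c^oo(U). *)
Definition test_function (U : set 'rV[R]_d) psi : Prop :=
  [/\ forall s, continuous (pds s psi),
      forall s i x, derivable (pds s psi) x (delta_mx ord0 i),
      compact (closure [set x | psi x != 0]) &
      closure [set x | psi x != 0] `<=` U].

Local Open Scope ereal_scope.

(** The signed measure nu is the i-th distributional derivative of f on U; the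
    integral against nu is expressed with its Jordan decomposition. *)
Definition is_distr_deriv (U : set 'rV[R]_d) i f
    (nu : {charge set 'rV[R]_d -> \bar R}) P N
    (nuPN : hahn_decomposition nu P N) : Prop :=
  forall psi, test_function U psi ->
    \int[lebesgue_rV d]_(x in U) (f x * pd i psi x)%:E =
    - (\int[jordan_pos nuPN]_(x in U) (psi x)%:E -
       \int[jordan_neg nuPN]_(x in U) (psi x)%:E).

(** |D_i f|(U). On U the measure D_i f is unique if it exists, so the infimum
    is over at most one value; it is +oo if D_i f is not a finite measure. *)
Definition distr_variation (U : set 'rV[R]_d) i f : \bar R :=
  ereal_inf [set y | exists (nu : {charge set 'rV[R]_d -> \bar R}) P N
    (nuPN : hahn_decomposition nu P N),
    is_distr_deriv U i f nuPN /\ y = charge_variation nuPN U].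

End derivatives.

Section bounds.
Context {R : realType} {d : nat}.
Variables (a b : 'rV[R]_d) (f phi : 'rV[R]_d -> R).
Implicit Type I : {set 'I_d}.
Local Open Scope ereal_scope.

Definition is_density : Prop :=
  [/\ forall x, box a b x -> (0 <= f x)%R,
      (lebesgue_rV d).-integrable (box a b) (EFin \o f) &
      \int[lebesgue_rV d]_(x in box a b) (f x)%:E = 1].

Definition expectation_f : \bar R :=
  \int[lebesgue_rV d]_(x in box a b) (phi x * f x)%:E.

Definition TV_ I : \bar R := \sum_(i in I) distr_variation (box a b)° i f.

Definition B_TV I : \bar R :=
  ((2 * #|I|%:R)^-1)%:E * Lambda_sl a b I (P_ a b I phi) * TV_ I.

(** [f] is only given on S, so its derivatives are integrated over the
    interior; the boundary of S is a null set. *)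
Definition B_mix I : \bar R :=
  (2 ^- #|I|)%:E * Lambda_mix a b I (P_ a b I phi) *
  \int[lebesgue_rV d]_(x in (box a b)°) `|pds (enum I) f x|%:E.

Definition Delta_ I : \bar R := Linfty_norm a b (R_ a b I phi).

End bounds.

(* Main.v *)
Require Import Defs.
From HB Require Import structures.
From mathcomp Require Import all_boot all_order all_algebra.
From mathcomp Require Import all_classical all_reals all_analysis.
From mathcomp Require Import ess_sup_inf measurable_realfun.
From mathcomp Require Import ring lra.

Set Implicit Arguments.
Unset Strict Implicit.
Unset Printing Implicit Defensive.

Import Order.TTheory GRing.Theory Num.Theory.
Import numFieldNormedType.Exports.
Local Open Scope classical_set_scope.
Local Open Scope ring_scope.

(** The function phi is the sum of [P_ I phi], which has mean zero along every
    edge in a direction of I, and of [R_ I phi]. Since f is a probability density,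
    the second summand contributes at most its essential supremum, [Delta_].

    For the first summand, integrate by parts. On an interval, if p has mean zero
    then the integral of p G is minus the integral of T p times G', where T p is
    the antiderivative of p; the mean zero condition allows T to be written with
    the kernel sgn(tau - t) / 2 ([half_sgn_by_parts]), so that |T p| is at most
    half of the integral of |p|. In the box, T acts in one coordinate and commutes
    with the projectors in the other ones, so the mean zero condition in the
    remaining directions survives and the step can be repeated in all directions
    of a list s ([int_box_antider_le]): up to sign, the integral of P_I phi f is
    that of an iterated antiderivative against the mixed derivative of f, and the
    antiderivative is bounded by 2^-|s| times the integral of |P_I phi| over the
    coordinates in s. That integral is bounded almost everywhere by
    [Lambda_mix] when s lists I, which gives [B_mix]
    ([residual_mix_bound]). It is bounded by [Lambda_sl] when s is a single
    direction i of I, which bounds the integral of |d_i f| instead; averaging over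
    I gives [B_TV] ([residual_TV_bound]).

    Apart from exchanges of two integrals along edges, Fubini's theorem enters
    through one identity, [int_box_edge_int]: replacing a function by its integral
    along an edge multiplies its integral over the box by the length of the edge.
    This identity also shows that null sets have null slices, so that
    phi may be replaced by a bounded Borel function.

    Finally the integral of |d_i f| is at most the total variation of any measure
    nu that is the distributional derivative of f
    ([int_normr_le_distr_variation]). Testing with smooth bumps that
    converge to the indicator of an open box shows that nu has density d_i f on
    open boxes, hence on Borel sets, and it remains to evaluate nu on the sets
    where d_i f is positive and nonpositive. *)

(** * Open boxes and the measure of rectangles *)

Section rectangles.
Context {R : realType}.
Implicit Types n : nat.

Definition rect n (A : 'I_n -> set R) : set 'rV[R]_n :=
  [set x | forall i, A i (x ord0 i)].

Definition obox n (c e : 'rV[R]_n) : set 'rV[R]_n :=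
  rect (fun i => `]c ord0 i, e ord0 i[%classic).

Lemma rectE n (A : 'I_n -> set R) :
  rect A = \bigcap_(i in setT) ((fun x : 'rV[R]_n => x ord0 i) @^-1` A i).
Proof. by apply/seteqP; split=> [x + i _|x + i]; apply. Qed.

Lemma measurable_rect n (A : 'I_n -> set R) :
  (forall i, measurable (A i)) -> measurable (rect A).
Proof.
move=> mA; rewrite rectE; apply: fin_bigcap_measurable => [|i _].
  exact: finite_finset.
by rewrite -[X in measurable X]setTI; exact: measurable_coord.
Qed.

Lemma measurable_obox n (c e : 'rV[R]_n) : measurable (obox c e).
Proof. by apply: measurable_rect => i; exact: measurable_itv. Qed.

Lemma obox_setI n (c e c' e' : 'rV[R]_n) :
  obox c e `&` obox c' e' =
  obox (\row_i Num.max (c ord0 i) (c' ord0 i))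
       (\row_i Num.min (e ord0 i) (e' ord0 i)).
Proof.
apply/seteqP; split=> x /=.
  move=> [xce xce'] i; rewrite !mxE /= in_itv/=.
  move: (xce i) (xce' i); rewrite /= !in_itv/= => /andP[? ?] /andP[? ?].
  by rewrite gt_max lt_min; apply/andP; split; apply/andP.
move=> xce; split=> i; move: (xce i); rewrite /= !mxE !in_itv/= gt_max lt_min.
  by move=> /andP[/andP[-> _] /andP[-> _]].
by move=> /andP[/andP[_ ->] /andP[_ ->]].
Qed.

(** A half-line condition on one coordinate is the increasing union of open
    boxes, because the other coordinates of a point have a common bound. *)
Lemma obox_generates n : (@measurable _ 'rV[R]_n) =
  <<s [set A | exists c e : 'rV[R]_n, A = obox c e] >>.
Proof.
rewrite eqEsubset; split=> A; last first.
  apply: smallest_sub; first exact: sigma_algebra_measurable.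
  by move=> _ [c [e ->]]; exact: measurable_obox.
set G := [set A | _].
apply: smallest_sub; first exact: smallest_sigma_algebra.
move=> B; rewrite -bigcup_seq => -[i _ [Y mY <-]] /=; rewrite setTI.
have {}mY : (@measurable_realfun.RGenOInfty.G R).-sigma.-measurable Y.
  by rewrite -measurable_realfun.RGenOInfty.measurableE.
suff : <<s @measurable_realfun.RGenOInfty.G R >> `<=`
    [set Z | <<s G >> ((fun x : 'rV[R]_n => x ord0 i) @^-1` Z)] by apply.
have sG := @smallest_sigma_algebra _ setT G.
apply: smallest_sub.
  split=> /=.
  - by rewrite preimage_set0; case: sG.
  - by move=> Z /= ?; rewrite setTD preimage_setC -setTD; case: sG => _ + _; apply.
  - by move=> F mF; rewrite preimage_bigcup; case: sG => _ _; apply.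
move=> _ [c ->] /=.
have -> : (fun x : 'rV[R]_n => x ord0 i) @^-1` `]c, +oo[ = \bigcup_k
    obox (\row_j (if j == i then c else - k%:R)) (const_mx k%:R).
  apply/seteqP; split=> x; rewrite /= in_itv/= ?andbT.
    move=> cx; have [k kx] : exists k : nat, forall j, `|x ord0 j| < k%:R.
      exists (Num.bound (\sum_j `|x ord0 j|)) => j.
      rewrite (le_lt_trans _ (archi_boundP _)) ?sumr_ge0//.
      by rewrite (bigD1 j)//= lerDl sumr_ge0.
    exists k => // j; rewrite /= !mxE in_itv/=.
    by have := kx j; rewrite ltr_norml => /andP[k1 ->]; case: eqP => [->|_];
        rewrite ?cx ?k1.
  by move=> [k _ /(_ i)]; rewrite /= !mxE eqxx in_itv/= => /andP[].
by case: sG => _ _; apply=> k; apply: sub_gen_smallest; do 2 eexists.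
Qed.

Lemma obox_setI_closed n :
  setI_closed [set A | exists c e : 'rV[R]_n, A = obox c e].
Proof. by move=> _ _ [c [e ->]] [c' [e' ->]]; rewrite obox_setI; do 2 eexists. Qed.

(** The form in which the pi-lambda theorem is used: image measures are
    identified by computing products of lengths of intervals. *)
Lemma obox_measure_unique n
    (m1 m2 : {measure set 'rV[R]_n -> \bar R}) :
  (forall c e, m1 (obox c e) = m2 (obox c e)) ->
  (forall c e, m1 (obox c e) < +oo)%E ->
  forall A, measurable A -> m1 A = m2 A.
Proof.
move=> m12 m1oo; apply: (@measure_unique _ _ _ _ (fun k => obox (const_mx (-
    k%:R)) (const_mx k%:R))).
- exact: obox_generates.
- exact: obox_setI_closed.
- by move=> k; do 2 eexists.
- apply/seteqP; split => // x _.
  exists (Num.bound (\sum_j `|x ord0 j|)) => // j; rewrite /= !mxE in_itv/= -ltr_norml.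
  rewrite (le_lt_trans _ (archi_boundP _)) ?sumr_ge0//.
  by rewrite (bigD1 j)//= lerDl sumr_ge0.
- by move=> _ [c [e ->]]; exact: m12.
- by [].
Qed.

Lemma rV_cons_head n t (x : 'rV[R]_n) : rV_cons (t, x) ord0 ord0 = t.
Proof.
rewrite /rV_cons (_ : ord0 = lshift n (ord0 : 'I_1)); last exact/val_inj.
by rewrite row_mxEl mxE.
Qed.

Lemma rV_cons_tail n t (x : 'rV[R]_n) i :
  rV_cons (t, x) ord0 (lift ord0 i) = x ord0 i.
Proof.
rewrite /rV_cons (_ : lift ord0 i = rshift 1 i); last exact/val_inj.
by rewrite row_mxEr.
Qed.

Local Open Scope ereal_scope.

Lemma lebesgue_rV_rect n (A : 'I_n -> set R) :
  (forall i, measurable (A i)) ->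
  lebesgue_rV n (rect A) = \prod_(i < n) (@lebesgue_measure R (A i)).
Proof.
elim: n A => [|n IHn] A mA.
  rewrite big_ord0 /= diracE mem_set//; first by case.
rewrite [LHS]/= /lebesgue_rV_step /pushforward.
rewrite (_ : _ @^-1` _ = A ord0 `*` rect (fun i => A (lift ord0 i))).
  rewrite product_measure1E ?IHn//; first by rewrite big_ord_recl.
  - exact: mA.
  - by apply: (@measurable_rect n (fun i => A (lift ord0 i))) => i; exact: mA.
apply/seteqP; split => [[t x] /= Atx|[t x] /= [At Ax] i].
  split => [|i]; first by have := Atx ord0; rewrite rV_cons_head.
  by have := Atx (lift ord0 i); rewrite rV_cons_tail.
by case: (unliftP ord0 i) => [j ->|->]; rewrite (rV_cons_tail, rV_cons_head).
Qed.

End rectangles.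

(** * Continuous functions on a closed box *)

Section continuity.
Context {R : realType} {n : nat}.
Implicit Types (U : set 'rV[R]_n) (x : 'rV[R]_n).

Lemma ball_rVE x (e : R) : 0 < e -> ball x e =
  rect (fun i => `]x ord0 i - e, x ord0 i + e[%classic).
Proof.
move=> e0; apply/seteqP; split=> y; rewrite /ball/= /mx_ball.
  by move=> [_ +] i => /(_ ord0 i); rewrite /= in_itv/= /ball/= ltr_distlC.
by move=> h; split=> // i j; rewrite ord1; have := h j; rewrite /= in_itv/=
    /ball/= ltr_distlC.
Qed.

(** An open set is the union of the cubes of rational centre and radius 1/(k+1)
    that it contains, and there are countably many of those. *)
Lemma open_measurable_rV U : open U -> measurable U.
Proof.
move=> oU.
pose F (p : 'rV[rat]_n * nat) := let B :=
  rect (fun i => `]ratr (p.1 ord0 i) - p.2.+1%:R^-1 : R,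
                   ratr (p.1 ord0 i) + p.2.+1%:R^-1[%classic) in
  [set x | B x /\ B `<=` U].
have -> : U = \bigcup_p F p.
  apply/seteqP; split=> [x Ux|x [p _ [Bx]]]; last exact.
  have /nbhs_ballP[e /= e0 xeU] : nbhs x U by exact: open_nbhs_nbhs.
  (* The rational centre is within 1/(k+1) of x, so the cube lies within
     2/(k+1) of x. *)
  pose k := Num.bound (2 / e).
  have ke : 2 * k.+1%:R^-1 < e.
    rewrite ltr_pdivrMr// mulrC -ltr_pdivrMr//.
    by rewrite (lt_le_trans (archi_boundP _)) ?ler_nat// divr_ge0// ltW.
  have k0 : 0 < k.+1%:R^-1 :> R by rewrite invr_gt0.
  have /choice[q qx] : forall i, exists q : rat,
      ratr q \in `]x ord0 i - k.+1%:R^-1, x ord0 i + k.+1%:R^-1[.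
    by move=> i; apply: rat_in_itvoo; rewrite ltrBlDr -addrA ltrDl addr_gt0.
  exists (\row_i q i, k) => //; split=> [i|y By].
    have := qx i; rewrite /= !in_itv/= !mxE /=; move: (k.+1%:R^-1) => s.
    by move=> /andP[? ?]; apply/andP; split; lra.
  apply: xeU; rewrite ball_rVE// => i; have := By i; have := qx i.
  rewrite /= !in_itv/= !mxE /=; move: ke k0; move: (k.+1%:R^-1) => s ke k0.
  by move=> /andP[? ?] /andP[? ?]; apply/andP; split; lra.
apply: countable_bigcupT_measurable; first exact: countableP.
move=> p; have [BU|BU] := pselect (rect (fun i => `]ratr (p.1 ord0 i) - p.2.+1%:R^-1 : R,
                   ratr (p.1 ord0 i) + p.2.+1%:R^-1[%classic) `<=` U).
  rewrite [X in measurable X](_ : _ = rect (fun i => `]ratr (p.1 ord0 i) -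
      p.2.+1%:R^-1 : R,
                   ratr (p.1 ord0 i) + p.2.+1%:R^-1[%classic)).
    by apply: measurable_rect => i; exact: measurable_itv.
  by apply/seteqP; split=> [x []//|x Bx].
rewrite [X in measurable X](_ : _ = set0)//.
by rewrite -subset0 => x [].
Qed.

Lemma within_continuous_measurable D (f : 'rV[R]_n -> R) :
  measurable D -> {within D, continuous f} -> measurable_fun D f.
Proof.
move=> mD /continuousP cf; apply: (measurability _
    (@measurable_realfun.RGenOpens.measurableE R)).
move=> _ [_ [a [c ->] <-]].
have /open_subspaceP[V oV VD] := cf _ (itv_open a c).
rewrite setIC -VD.
by apply: measurableI => //; exact: open_measurable_rV.
Qed.

Variables a b : 'rV[R]_n.

Lemma compact_box : compact (box a b).
Proof.
have : compact [set v : 'rV[R]_n | forall i, `[a ord0 i, b ord0 i]%classic (v ord0 i)].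
  apply: (@rV_compact R n (fun i => `[a ord0 i, b ord0 i]%classic)) => i.
  exact: segment_compact.
by congr compact; apply/seteqP; split=> x h i; have := h i; rewrite /= in_itv.
Qed.

Lemma within_box_bounded (f : 'rV[R]_n -> R) : {within box a b, continuous f} ->
  exists M, forall x, box a b x -> `|f x| <= M.
Proof.
move=> cf; have := continuous_compact cf compact_box.
move=> /compact_bounded[M [_ /(_ (M + 1))]]; rewrite ltrDl ltr01 => /(_ isT) h.
by exists (M + 1) => x bx; apply: h; exists x.
Qed.

Lemma interior_box : (box a b)° = obox a b.
Proof.
apply/seteqP; split=> x.
  rewrite /interior => /nbhs_ballP[e /= e0 xe] i; rewrite /= in_itv/=.
  have xj (s : R) : `|s| < e -> box a b (\row_j (x ord0 j + s)).
    move=> se; apply: xe; rewrite ball_rVE// => j; rewrite /= mxE in_itv/=.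
    by move: se; rewrite ltr_norml => /andP[? ?]; apply/andP; split; lra.
  have h : `|e / 2| < e by rewrite ger0_norm ?divr_ge0 ?ltW//; lra.
  have /andP[_] := xj _ h i; rewrite mxE => xb.
  have := xj (- (e / 2)); rewrite normrN => /(_ h i)/andP[+ _]; rewrite mxE => ax.
  by apply/andP; split; lra.
move=> abx; have : \forall y \near x, forall i, `]a ord0 i, b ord0 i[%classic ((y
    : 'rV[R]_n) ord0 i).
  apply: (@filter_forall _ _ (fun i y => `]a ord0 i, b ord0 i[%classic ((y :
      'rV[R]_n) ord0 i)) (nbhs x) _ _) => i.
  apply: (@coord_continuous R 1 n ord0 i x).
  by apply: open_nbhs_nbhs; split; [exact: itv_open|exact: abx].
apply: filterS => y aby i.
by have := aby i; rewrite /= in_itv/= => /andP[/ltW -> /ltW ->].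
Qed.

Lemma boxE : box a b = rect (fun i => `[a ord0 i, b ord0 i]%classic).
Proof. by apply/seteqP; split=> x h i; have := h i; rewrite /= in_itv. Qed.

Lemma obox_sub_box : obox a b `<=` box a b.
Proof. by rewrite -interior_box; exact: interior_subset. Qed.

Local Open Scope ereal_scope.
Hypothesis ab : forall i, (a ord0 i < b ord0 i)%R.

Lemma lebesgue_rV_box : lebesgue_rV n (box a b) = (\prod_i (b ord0 i - a ord0 i))%:E.
Proof.
rewrite boxE lebesgue_rV_rect => [|i]; last exact: measurable_itv.
rewrite -prodEFin; apply: eq_bigr => i _.
by rewrite lebesgue_measure_itv/= lte_fin ab EFinB.
Qed.

Lemma lebesgue_rV_obox : lebesgue_rV n (obox a b) = (\prod_i (b ord0 i - a ord0 i))%:E.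
Proof.
rewrite lebesgue_rV_rect => [|i]; last exact: measurable_itv.
rewrite -prodEFin; apply: eq_bigr => i _.
by rewrite lebesgue_measure_itv/= lte_fin ab EFinB.
Qed.

(** Functions that are only controlled in the interior of the box can thus be
    integrated over the closed box, which is the convenient domain for slices. *)
Lemma lebesgue_box_boundary : lebesgue_rV n (box a b `\` obox a b) = 0.
Proof.
rewrite measureD/=; last 3 first.
- exact: measurable_box.
- exact: measurable_obox.
- by rewrite lebesgue_rV_box ltry.
rewrite setIidr; last exact: obox_sub_box.
by rewrite lebesgue_rV_box lebesgue_rV_obox subee.
Qed.

End continuity.

(** * Bounded Borel functions *)

Section bounded_measurable.
Context {R : realType}.

(** This class is stable under all operators below and integrable on sets of
    finite measure, which removes integrability conditions; essentially bounded
    functions have representatives in it. *)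
Definition bmf d (T : measurableType d) (g : T -> R) :=
  measurable_fun setT g /\ exists M, forall x, `|g x| <= M.

Section calculus.
Context d (T : measurableType d).
Implicit Types g h : T -> R.

Lemma bmf_cst r : bmf (fun _ : T => r).
Proof. by split; [exact: measurable_cst | exists `|r|]. Qed.

Lemma bmfD g h : bmf g -> bmf h -> bmf (fun x => g x + h x).
Proof.
move=> [mg [M gM]] [mh [N hN]]; split; first exact: measurable_funD.
by exists (M + N) => x; rewrite (le_trans (ler_normD _ _))// lerD.
Qed.

Lemma bmfM g h : bmf g -> bmf h -> bmf (fun x => g x * h x).
Proof.
move=> [mg [M gM]] [mh [N hN]]; split; first exact: measurable_funM.
by exists (M * N) => x; rewrite normrM ler_pM.
Qed.

Lemma bmfN g : bmf g -> bmf (fun x => - g x).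
Proof.
move=> [mg [M gM]]; split; first exact: measurableT_comp.
by exists M => x; rewrite normrN.
Qed.

Lemma bmfB g h : bmf g -> bmf h -> bmf (fun x => g x - h x).
Proof. by move=> bg bh; apply: bmfD => //; exact: bmfN. Qed.

Lemma bmf_normr g : bmf g -> bmf (fun x => `|g x|).
Proof.
move=> [mg [M gM]]; split; first exact: measurableT_comp.
by exists M => x; rewrite normr_id.
Qed.

Lemma bmf_comp d' (U : measurableType d') (p : U -> T) g :
  measurable_fun setT p -> bmf g -> bmf (fun u => g (p u)).
Proof.
move=> mp [mg [M gM]]; split; last by exists M => u.
exact: (measurableT_comp mg mp).
Qed.

Lemma bmf_patch (D : set T) g : measurable D -> measurable_fun D g ->
  (exists M, forall x, D x -> `|g x| <= M) -> bmf (g \_ D).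
Proof.
move=> mD mg [M gM]; split; first exact/(measurable_restrictT _ mD).1.
exists `|M| => x; rewrite patchE; case: ifPn => [/set_mem/gM|_].
  by move/le_trans; apply; exact: ler_norm.
by rewrite normr0.
Qed.

Lemma bmf_integrable (mu : {measure set T -> \bar R}) D g :
  measurable D -> (mu D < +oo)%E -> bmf g -> mu.-integrable D (EFin \o g).
Proof.
move=> mD muD [mg [M gM]].
apply: measurable_bounded_integrable => //; first exact: measurable_funTS.
exists M; split; first by rewrite num_real.
by move=> N MN x Dx; apply: le_trans (gM x) _; exact: ltW.
Qed.

Lemma EFin_bmf_int (mu : {measure set T -> \bar R}) D g :
  measurable D -> (mu D < +oo)%E -> bmf g ->
  (\int[mu]_(x in D) g x)%:E = (\int[mu]_(x in D) (g x)%:E)%E.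
Proof.
by move=> mD muD bg; rewrite /Rintegral fineK// integrable_fin_num// bmf_integrable.
Qed.

End calculus.

Section partial_integrals.
Context d1 d2 (T1 : measurableType d1) (T2 : measurableType d2).
Variables (m2 : {sigma_finite_measure set T2 -> \bar R}).
Variables (D2 : set T2) (mD2 : measurable D2).

Lemma measurable_fun_int_ge0 (F : T1 * T2 -> \bar R) :
  measurable_fun setT F -> (forall z, 0 <= F z)%E ->
  measurable_fun setT (fun x => \int[m2]_(y in D2) F (x, y))%E.
Proof.
move=> mF F0.
have -> : (fun x => \int[m2]_(y in D2) F (x, y))%E =
    fubini_F m2 (F \_ (setT `*` D2)).
  apply/funext => x; rewrite integral_mkcond; apply: eq_integral => y _.
  by rewrite !patchE in_setX in_setT.
apply: measurable_fun_fubini_tonelli_F.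
  apply/(measurable_restrictT _ _).1; last exact: measurable_funTS.
  exact: measurableX.
by move=> z; rewrite patchE; case: ifPn.
Qed.

(** Slices of [F] may fail to be integrable: positive and negative parts are
    handled by Tonelli's theorem, and [fine] is a measurable function. *)
Lemma measurable_fun_Rint (F : T1 * T2 -> R) : measurable_fun setT F ->
  measurable_fun setT (fun x => \int[m2]_(y in D2) F (x, y)).
Proof.
move=> mF; have mEF : measurable_fun setT (EFin \o F) by exact/measurable_EFinP.
apply: measurableT_comp => //.
under eq_fun do rewrite integralE.
apply: emeasurable_funB.
- rewrite (_ : (fun x => _) =
      (fun x => \int[m2]_(y in D2) ((EFin \o F)^\+)%E (x, y))%E); last first.
    by apply/funext => x; apply: eq_integral => y _; rewrite !funeposE.
  by apply: measurable_fun_int_ge0 => //; exact: measurable_funepos.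
- rewrite (_ : (fun x => _) =
      (fun x => \int[m2]_(y in D2) ((EFin \o F)^\-)%E (x, y))%E); last first.
    by apply/funext => x; apply: eq_integral => y _; rewrite !funenegE.
  by apply: measurable_fun_int_ge0 => //; exact: measurable_funeneg.
Qed.

Hypothesis fD2 : (m2 D2 < +oo)%E.

Lemma bmf_int (F : T1 * T2 -> R) : bmf F ->
  bmf (fun x => \int[m2]_(y in D2) F (x, y)).
Proof.
move=> bF; have [mF [M FM]] := bF; split; first exact: measurable_fun_Rint.
exists (M * fine (m2 D2)) => x.
have bFx : bmf (fun y => F (x, y)).
  by apply: (bmf_comp (p := fun y => (x, y))) bF; exact: measurable_pair1.
rewrite (le_trans (le_normr_Rintegral _ _))//.
  exact: bmf_integrable.
rewrite -Rintegral_cst//; apply: le_Rintegral => //.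
- by apply: bmf_integrable => //; exact: bmf_normr.
- by apply: bmf_integrable => //; exact: bmf_cst.
Qed.

End partial_integrals.

Section fubini.
Context d1 d2 (T1 : measurableType d1) (T2 : measurableType d2).
Variables (m1 : {sigma_finite_measure set T1 -> \bar R}).
Variables (m2 : {sigma_finite_measure set T2 -> \bar R}).
Variables (D1 : set T1) (D2 : set T2).
Hypotheses (mD1 : measurable D1) (mD2 : measurable D2).
Hypotheses (fD1 : (m1 D1 < +oo)%E) (fD2 : (m2 D2 < +oo)%E).

Lemma EFin_bmf_int_prod (F : T1 * T2 -> R) : bmf F ->
  (\int[m1]_(x in D1) \int[m2]_(y in D2) F (x, y))%:E =
  (\int[m1 \x m2]_(z in D1 `*` D2) (F z)%:E)%E.
Proof.
move=> bF.
have iF : (m1 \x m2)%E.-integrable setT ((EFin \o F) \_ (D1 `*` D2)).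
  apply/(integrable_mkcond _ _).1; first exact: measurableX.
  apply: bmf_integrable => //; first exact: measurableX.
  by rewrite /= product_measure1E// lte_mul_pinfty// ge0_fin_numE.
rewrite EFin_bmf_int//; last exact: bmf_int.
rewrite [RHS]integral_mkcond -(integral12_prod_meas1 iF) integral_mkcond.
apply: eq_integral => x _; rewrite /fubini_F patchE; case: ifPn => xD; last first.
  by rewrite integral0_eq// => y _; rewrite patchE in_setX (negbTE xD).
rewrite EFin_bmf_int//; last exact: (bmf_comp (measurable_pair1 x)).
rewrite integral_mkcond; apply: eq_integral => y _.
by rewrite !patchE in_setX xD.
Qed.

Lemma bmf_Fubini (F : T1 * T2 -> R) : bmf F ->
  \int[m1]_(x in D1) \int[m2]_(y in D2) F (x, y) =
  \int[m2]_(y in D2) \int[m1]_(x in D1) F (x, y).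
Proof.
move=> bF; have [mF [M FM]] := bF.
have iF : (m1 \x m2)%E.-integrable setT ((EFin \o F) \_ (D1 `*` D2)).
  apply/(integrable_mkcond _ _).1; first exact: measurableX.
  apply: bmf_integrable => //; first exact: measurableX.
  by rewrite /= product_measure1E// lte_mul_pinfty// ge0_fin_numE.
have patchE12 x y : ((EFin \o F) \_ (D1 `*` D2)) (x, y) =
    ((fun x => ((fun y => (F (x, y))%:E) \_ D2) y) \_ D1) x.
  by rewrite !patchE in_setX/=; case: (x \in D1); case: (y \in D2).
have E1 : (\int[m1]_(x in D1) \int[m2]_(y in D2) F (x, y))%:E =
    (\int[m1]_x \int[m2]_y ((EFin \o F) \_ (D1 `*` D2)) (x, y))%E.
  rewrite EFin_bmf_int//; last exact: bmf_int.
  rewrite integral_mkcond; apply: eq_integral => x _.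
  under eq_integral do rewrite patchE12.
  rewrite patchE; case: ifPn => xD; last first.
    by rewrite integral0_eq// => y _; rewrite patchE (negbTE xD).
  rewrite EFin_bmf_int//; last exact: (bmf_comp (measurable_pair1 x)).
  by rewrite integral_mkcond; apply: eq_integral => y _; rewrite [RHS]patchE xD.
have E2 : (\int[m2]_(y in D2) \int[m1]_(x in D1) F (x, y))%:E =
    (\int[m2]_y \int[m1]_x ((EFin \o F) \_ (D1 `*` D2)) (x, y))%E.
  rewrite EFin_bmf_int//; last first.
    apply: (bmf_int mD1 fD1 (F := fun z => F (z.2, z.1))).
    by apply: bmf_comp bF; exact: measurable_swap.
  rewrite integral_mkcond; apply: eq_integral => y _.
  rewrite patchE; case: ifPn => yD; last first.
    by rewrite integral0_eq// => x _; rewrite patchE in_setX (negbTE yD) andbF.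
  rewrite EFin_bmf_int//; last exact: (bmf_comp (measurable_pair2 y)).
  rewrite integral_mkcond; apply: eq_integral => x _.
  by rewrite !patchE in_setX yD andbT.
by apply: EFin_inj; rewrite E1 E2; exact: Fubini.
Qed.

End fubini.

Lemma integral_mrestr d (T : measurableType d) (mu : {measure set T -> \bar R})
    (D : set T) (mD : measurable D) (f : T -> R) :
  (mu D < +oo)%E -> bmf f ->
  (\int[mrestr mu mD]_x (f x)%:E = \int[mu]_(x in D) (f x)%:E)%E.
Proof.
move=> muD bf.
rewrite (@negligible_integral _ _ _ _ setT (~` D)) ?setTD ?setCK//.
- by apply: eq_measure_integral => A mA AD; rewrite /= /mrestr setIidl.
- exact: measurableC.
- by apply: bmf_integrable => //; rewrite /= /mrestr setTI.
- by rewrite /= /mrestr setICl measure0.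
Qed.

End bounded_measurable.

(** * Averaging over one coordinate *)

Section coordinate_slices.
Context {R : realType} {n : nat}.
Implicit Types (x : 'rV[R]_n) (i j : 'I_n) (s t : R).

Lemma set_coordE x i t : set_coord x i t ord0 i = t.
Proof. by rewrite mxE eqxx. Qed.

Lemma set_coord_neq x i j t : j != i -> set_coord x i t ord0 j = x ord0 j.
Proof. by rewrite mxE => /negbTE ->. Qed.

Lemma set_coord_id x i : set_coord x i (x ord0 i) = x.
Proof. by apply/rowP => j; rewrite mxE; case: eqP => [->|]. Qed.

Lemma set_coord_set x i s t : set_coord (set_coord x i s) i t = set_coord x i t.
Proof. by apply/rowP => j; rewrite !mxE; case: eqP. Qed.

Lemma set_coordC x i j s t : i != j ->
  set_coord (set_coord x i s) j t = set_coord (set_coord x j t) i s.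
Proof.
move=> ij; apply/rowP => k; rewrite !mxE.
by case: eqP => [->|//]; rewrite eq_sym (negbTE ij).
Qed.

Lemma measurable_set_coord i : measurable_fun setT
  (fun z : 'rV[R]_n * measurableTypeR R => set_coord z.1 i z.2).
Proof.
apply: measurable_fun_coord => j.
have [->|ji] := eqVneq j i.
  by under eq_fun do rewrite set_coordE; exact: measurable_snd.
under eq_fun do rewrite set_coord_neq//.
exact: (measurableT_comp (measurable_coord j) measurable_fst).
Qed.

End coordinate_slices.

Section averaging.
Context {R : realType} {n : nat}.
Variables (a b : 'rV[R]_n).
Hypothesis ab : forall i, a ord0 i < b ord0 i.
Implicit Types (x : 'rV[R]_n) (i j : 'I_n) (g h : 'rV[R]_n -> R).
Local Notation mu := (@lebesgue_rV R n).
Local Notation lam := (@lebesgue_measure R).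
Local Notation edge i := `[a ord0 i, b ord0 i]%classic.

Definition edge_int i g x : R := \int[lam]_(t in edge i) g (set_coord x i t).

Lemma lebesgue_edge i : lam (edge i) = (b ord0 i - a ord0 i)%:E.
Proof. by rewrite lebesgue_measure_itv/= lte_fin ab EFinB. Qed.

Lemma lebesgue_edge_fin i : (lam (edge i) < +oo)%E.
Proof. by rewrite lebesgue_edge ltry. Qed.

Lemma lebesgue_box_fin : (mu (box a b) < +oo)%E.
Proof. by rewrite lebesgue_rV_box// ltry. Qed.

Lemma lebesgue_obox_fin : (mu (obox a b) < +oo)%E.
Proof. by rewrite lebesgue_rV_obox// ltry. Qed.

Let len_ge0 i : 0 <= b ord0 i - a ord0 i.
Proof. by rewrite subr_ge0 ltW. Qed.

Let mBE i : measurable (box a b `*` edge i).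
Proof. by apply: measurableX; [exact: measurable_box|exact: measurable_itv]. Qed.

Let box_edge_rect i (A : 'I_n -> set R) :
  (box a b `*` edge i) `&` (fun z => set_coord z.1 i z.2) @^-1` rect A =
  rect (fun j => edge j `&` (if j == i then setT else A j)) `*` (edge i `&` A i).
Proof.
apply/seteqP; split=> -[x t] /=.
  move=> [[bx et] xtA]; split; last by split => //; have := xtA i; rewrite set_coordE.
  move=> j; split; first by have := bx j; rewrite /= in_itv.
  by case: ifPn => // ji; have := xtA j; rewrite set_coord_neq.
move=> [xA [et At]]; split; first split => // j.
  by have [] := xA j; rewrite /= in_itv.
move=> j; have [->|ji] := eqVneq j i; first by rewrite set_coordE.
by rewrite set_coord_neq//; have [_] := xA j; rewrite (negbTE ji).
Qed.

Local Open Scope ereal_scope.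

(** Resampling coordinate i uniformly preserves the uniform measure of the box.
    Both sides are measures in [A], and on an open box each of them is a product
    of lengths of intervals. *)
Lemma edge_pushforward i (A : set 'rV[R]_n) : measurable A ->
  (mu \x lam)%E ((box a b `*` edge i) `&` (fun z => set_coord z.1 i z.2) @^-1` A) =
  (b ord0 i - a ord0 i)%:E * mu (box a b `&` A).
Proof.
move=> mA.
pose m1 := measure_function_pushforward__canonical__measure_function_Measure
   (mrestr (mu \x lam)%E (mBE i)) (measurable_set_coord i).
pose m2 := mscale (NngNum (len_ge0 i)) (mrestr mu (measurable_box a b)).
have m1E B : m1 B =
    (mu \x lam)%E ((box a b `*` edge i) `&` (fun z => set_coord z.1 i z.2) @^-1` B).
  by rewrite setIC.
have m2E B : m2 B = (b ord0 i - a ord0 i)%:E * mu (box a b `&` B).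
  by rewrite setIC.
rewrite -m1E -m2E.
have m12 (c e : 'rV[R]_n) : m1 (obox c e) = m2 (obox c e).
  rewrite m1E m2E box_edge_rect; cbv beta.
  have mI j : measurable (edge j `&` `]c ord0 j, e ord0 j[%classic).
    by apply: measurableI; exact: measurable_itv.
  have mJ j : measurable (edge j `&` if j == i then setT else `]c ord0 j, e ord0
      j[%classic).
    apply: measurableI; first exact: measurable_itv.
    by case: ifP => _; [exact: measurableT|exact: measurable_itv].
  rewrite product_measure1E; [|exact: measurable_rect|exact: mI].
  rewrite boxE (_ : rect _ `&` obox c e =
    rect (fun j => edge j `&` `]c ord0 j, e ord0 j[%classic)); last first.
    by apply/seteqP; split=> [x [h k] j //|x h]; split=> j; have [] := h j.
  rewrite (lebesgue_rV_rect mI).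
  transitivity (\prod_j lam (edge j `&` if j == i then setT else `]c ord0 j, e
      ord0 j[%classic) * lam (edge i `&` `]c ord0 i, e ord0 i[%classic)).
    by congr (_ * _); exact: (lebesgue_rV_rect mJ).
  rewrite (bigD1 i)//= [in RHS](bigD1 i)//= eqxx setIT lebesgue_edge -!muleA.
  congr (_ * _); rewrite muleC; congr (_ * _).
  by apply: eq_bigr => j /negbTE ->.
apply: obox_measure_unique => // c e; rewrite m12.
rewrite m2E lte_mul_pinfty ?lee_fin// (le_lt_trans _ lebesgue_box_fin)//.
by rewrite le_measure ?inE//; [apply: measurableI|];
  [exact: measurable_box|exact: measurable_obox|exact: measurable_box].
Qed.

Lemma bmf_slice i g : bmf g ->
  bmf (fun z : 'rV[R]_n * measurableTypeR R => g (set_coord z.1 i z.2)).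
Proof. by apply: bmf_comp; exact: measurable_set_coord. Qed.

Lemma bmf_slice1 i g x : bmf g ->
  bmf (fun t : measurableTypeR R => g (set_coord x i t)).
Proof. by move=> /(bmf_slice i)/(bmf_comp (measurable_pair1 x)). Qed.

Lemma bmf_edge_int i g : bmf g -> bmf (edge_int i g).
Proof.
move=> bg; apply: (@bmf_int _ _ _ _ _ lam _ _ _ (fun z => g (set_coord z.1 i z.2))).
- exact: measurable_itv.
- exact: lebesgue_edge_fin.
- exact: bmf_slice.
Qed.

Let shift i g M x : bmf g -> edge_int i (fun y => (g y + M)%R) x =
  (edge_int i g x + M * (b ord0 i - a ord0 i))%R.
Proof.
move=> bg; rewrite /edge_int RintegralD//.
- by rewrite Rintegral_cst//; congr (_ + _ * _)%R; have /= -> := lebesgue_edge i.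
- apply: bmf_integrable; [exact: measurable_itv|exact: lebesgue_edge_fin|].
  exact: bmf_slice1.
- apply: bmf_integrable; [exact: measurable_itv|exact: lebesgue_edge_fin|].
  exact: bmf_cst.
Qed.

(** Fubini's theorem in coordinate i, without splitting the space into a product:
    the inner integral remains a function of all coordinates. *)
Lemma int_box_edge_int i g : bmf g ->
  (\int[mu]_(x in box a b) edge_int i g x =
   (b ord0 i - a ord0 i) * \int[mu]_(x in box a b) g x)%R.
Proof.
move=> bg.
(* Adding a bound of g makes the monotone form of the change of variables
   applicable. *)
wlog g0 : g bg / forall x, (0 <= g x)%R.
  move=> wl; have [mg [M gM]] := bg.
  have bM : bmf (fun y => (g y + M)%R) by apply: bmfD => //; exact: bmf_cst.
  have := wl _ bM _; have -> : edge_int i (fun y => (g y + M)%R) =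
     (fun x => edge_int i g x + M * (b ord0 i - a ord0 i))%R.
    by apply/funext => x; rewrite shift.
  have mb := measurable_box a b; have fb := lebesgue_box_fin.
  rewrite !RintegralD//; last 4 first.
  - exact: bmf_integrable.
  - by apply: bmf_integrable => //; exact: bmf_cst.
  - by apply: bmf_integrable => //; exact: bmf_edge_int.
  - by apply: bmf_integrable => //; exact: bmf_cst.
  rewrite !Rintegral_cst// => h.
  suff : forall x, (0 <= g x + M)%R by move=> /h; lra.
  by move=> x; have := gM x; rewrite ler_norml => /andP[]; lra.
pose m1 := measure_function_pushforward__canonical__measure_function_Measure
   (mrestr (mu \x lam)%E (mBE i)) (measurable_set_coord i).
pose m2 := mscale (NngNum (len_ge0 i)) (mrestr mu (measurable_box a b)).
have [mg [M gM]] := bg.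
have mEg : measurable_fun setT (EFin \o g) by exact/measurable_EFinP.
apply: EFin_inj; rewrite EFinM.
transitivity (\int[mu \x lam]_(z in box a b `*` edge i) (g (set_coord z.1 i z.2))%:E).
  apply: (@EFin_bmf_int_prod _ _ _ _ _ mu lam _ _ _ _ _ _
    (fun z => g (set_coord z.1 i z.2))).
  - exact: measurable_box.
  - exact: measurable_itv.
  - exact: lebesgue_box_fin.
  - exact: lebesgue_edge_fin.
  - exact: bmf_slice.
have bSI : (mu \x lam) (box a b `*` edge i) < +oo.
  rewrite product_measure1E; [|exact: measurable_box|exact: measurable_itv].
  by rewrite lte_mul_pinfty// ?ge0_fin_numE// ?lebesgue_box_fin// lebesgue_edge_fin.
transitivity (\int[mrestr (mu \x lam) (mBE i)]_z (g (set_coord z.1 i z.2))%:E).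
  by rewrite integral_mrestr//; exact: bmf_slice.
transitivity (\int[m1]_x (g x)%:E).
  rewrite [RHS](ge0_integral_pushforward (measurable_set_coord i))//.
  by move=> x _; rewrite lee_fin.
transitivity (\int[m2]_x (g x)%:E).
  apply: eq_measure_integral => A mA _; have := edge_pushforward i mA.
  by rewrite setIC [X in _ * mu X]setIC.
rewrite /m2 ge0_integral_mscale//; last by move=> x _; rewrite lee_fin.
rewrite /= EFin_bmf_int//; [|exact: measurable_box|exact: lebesgue_box_fin].
by rewrite integral_mrestr//; exact: lebesgue_box_fin.
Qed.

End averaging.

(** * Kernel operators along an edge *)

Section edge_operators.
Context {R : realType} {n : nat}.
Variables (a b : 'rV[R]_n).
Hypothesis ab : forall i, a ord0 i < b ord0 i.
Implicit Types (x : 'rV[R]_n) (i j : 'I_n) (g h : 'rV[R]_n -> R).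
Implicit Types (k l : R * R -> R) (s : seq 'I_n).
Local Notation mu := (@lebesgue_rV R n).
Local Notation lam := (@lebesgue_measure R).
Local Notation edge i := `[a ord0 i, b ord0 i]%classic.

(** The projector [Pi_] has a constant kernel and the antiderivative below has
    the kernel [half_sgn]; their commutation for distinct coordinates is one
    application of Fubini's theorem. *)
Definition edge_op k i g x : R :=
  \int[lam]_(t in edge i) (k (x ord0 i, t) * g (set_coord x i t)).

Let bk k i : bmf k -> bmf (fun z : 'rV[R]_n * measurableTypeR R => k (z.1 ord0 i, z.2)).
Proof.
apply: bmf_comp; apply: measurable_fun_pair; last exact: measurable_snd.
exact: (measurableT_comp (measurable_coord i) measurable_fst).
Qed.

Lemma bmf_edge_op k i g : bmf k -> bmf g -> bmf (edge_op k i g).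
Proof.
move=> bmk bg; apply: (@bmf_int _ _ _ _ _ lam _ _ _
  (fun z : 'rV[R]_n * measurableTypeR R =>
     k (z.1 ord0 i, z.2) * g (set_coord z.1 i z.2))).
- exact: measurable_itv.
- exact: lebesgue_edge_fin.
- by apply: bmfM; [exact: bk|exact: bmf_slice].
Qed.

Lemma edge_integrable i (p : measurableTypeR R -> R) : bmf p ->
  lam.-integrable (edge i) (EFin \o p).
Proof. by apply: bmf_integrable; [exact: measurable_itv|exact: lebesgue_edge_fin]. Qed.

Lemma edge_int_itg i g x : bmf g ->
  lam.-integrable (edge i) (EFin \o (fun t => g (set_coord x i t))).
Proof. by move=> bg; exact/edge_integrable/bmf_slice1. Qed.

Lemma edge_op_itg k i g x : bmf k -> bmf g ->
  lam.-integrable (edge i) (EFin \o (fun t => k (x ord0 i, t) * g (set_coord x i t))).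
Proof.
move=> bmk bg; apply/edge_integrable/bmfM; last exact: bmf_slice1.
exact: (bmf_comp (measurable_pair1 _) bmk).
Qed.

Lemma edge_op_cst c i g : bmf g ->
  edge_op (fun=> c) i g = fun x => c * edge_int a b i g x.
Proof.
move=> bg; apply/funext => x; rewrite /edge_op RintegralZl//.
exact: edge_int_itg.
Qed.

Lemma Pi_E i g : bmf g ->
  Pi_ a b i g = edge_op (fun=> (b ord0 i - a ord0 i)^-1) i g.
Proof. by move=> bg; rewrite edge_op_cst. Qed.

Lemma bmf_Pi i g : bmf g -> bmf (Pi_ a b i g).
Proof. by move=> bg; rewrite Pi_E//; apply: bmf_edge_op => //; exact: bmf_cst. Qed.

Lemma edge_opC k l i j g : i != j -> bmf k -> bmf l -> bmf g ->
  edge_op k i (edge_op l j g) = edge_op l j (edge_op k i g).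
Proof.
move=> ij bmk bml bg; apply/funext => x.
have ji : j != i by rewrite eq_sym.
pose F (z : measurableTypeR R * measurableTypeR R) := k (x ord0 i, z.1) *
  (l (x ord0 j, z.2) * g (set_coord (set_coord x i z.1) j z.2)).
have bF : bmf F.
  apply: bmfM.
    apply: (bmf_comp (p := fun z => (x ord0 i, z.1))) bmk.
    exact: measurable_fun_pair.
  apply: bmfM.
    apply: (bmf_comp (p := fun z => (x ord0 j, z.2))) bml.
    exact: measurable_fun_pair.
  apply: (bmf_comp (p := fun z : measurableTypeR R * measurableTypeR R =>
      (set_coord x i z.1, z.2))) (bmf_slice j bg).
  apply: measurable_fun_pair; last exact: measurable_snd.
  apply: (measurableT_comp (measurable_set_coord i) (_ : measurable_fun setT (fun
      z => (x, z.1)))).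
  exact: measurable_fun_pair.
transitivity (\int[lam]_(t in edge i) \int[lam]_(s in edge j) F (t, s)).
  apply: eq_Rintegral => t _; rewrite /F/= RintegralZl//; last first.
    have := @edge_op_itg l j g (set_coord x i t) bml bg.
    by rewrite set_coord_neq.
  by rewrite /edge_op set_coord_neq.
rewrite (@bmf_Fubini _ _ _ _ _ lam lam (edge i) (edge j)) //; last 2 first.
- exact: lebesgue_edge_fin.
- exact: lebesgue_edge_fin.
apply: eq_Rintegral => s _; rewrite /edge_op set_coord_neq// -RintegralZl//; last first.
  have := @edge_op_itg k i g (set_coord x j s) bmk bg.
  by rewrite set_coord_neq.
by apply: eq_Rintegral => t _; rewrite /F/= set_coordC//; ring.
Qed.

Lemma edge_op0 k i : edge_op k i (fun=> 0) = fun=> 0.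
Proof.
apply/funext => x; rewrite /edge_op; under eq_Rintegral do rewrite mulr0.
by rewrite Rintegral_cst// mul0r.
Qed.

Lemma Pi_edge_op0 k i j g : i != j -> bmf k -> bmf g ->
  Pi_ a b i g = (fun=> 0) -> Pi_ a b i (edge_op k j g) = fun=> 0.
Proof.
move=> ij bmk bg; rewrite !Pi_E//; last exact: bmf_edge_op.
by rewrite edge_opC// => [->|]; [exact: edge_op0|exact: bmf_cst].
Qed.

Lemma PiB i g h : bmf g -> bmf h -> Pi_ a b i (g \- h) = Pi_ a b i g \- Pi_ a b i h.
Proof.
move=> bg bh; apply/funext => x; rewrite /Pi_/= RintegralB ?mulrBr//;
  exact: edge_int_itg.
Qed.

Lemma Pi_idem i g : Pi_ a b i (Pi_ a b i g) = Pi_ a b i g.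
Proof.
apply/funext => x; rewrite {1}/Pi_; under eq_Rintegral => t _.
  rewrite (_ : Pi_ a b i g _ = Pi_ a b i g x); first over.
  by rewrite /Pi_; congr (_ * _); apply: eq_Rintegral => s _; rewrite set_coord_set.
rewrite Rintegral_cst//=; have /= -> := lebesgue_edge ab i.
by rewrite /= mulrCA mulVf ?mulr1// subr_eq0 gt_eqF.
Qed.

Definition residual s g := foldr (fun i psi => psi \- Pi_ a b i psi) g s.

Lemma bmf_residual s g : bmf g -> bmf (residual s g).
Proof. by move=> bg; elim: s => //= i s IH; apply: bmfB => //; exact: bmf_Pi. Qed.

(** The projector [Pi_ i] kills its own factor of the product and commutes with
    the others. *)
Lemma Pi_residual s g i : bmf g -> i \in s -> Pi_ a b i (residual s g) = fun=> 0.
Proof.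
move=> bg; elim: s => //= j s IH; have br := bmf_residual s bg.
have bPr := bmf_Pi j br.
have [<- _|ij] := eqVneq i j.
  by rewrite PiB//; [rewrite Pi_idem; apply/funext => x /=; rewrite subrr|exact: bmf_Pi].
rewrite inE (negbTE ij)/= => /IH Pi0; rewrite PiB// Pi0.
rewrite [Pi_ a b j _]Pi_E// Pi_edge_op0//; first by apply/funext => x /=; rewrite subrr.
exact: bmf_cst.
Qed.

(** The antiderivative of [p] has the kernel that is 1 for [t <= tau] and 0
    otherwise. When [p] has mean zero a constant may be added to the kernel, and
    -1/2 is the constant that minimizes its absolute value: this is where the
    factors 1/2 of both bounds come from. *)
Definition half_sgn (z : R * R) : R := if z.2 <= z.1 then 2^-1 else - 2^-1.

Lemma normr_half_sgn z : `|half_sgn z| = 2^-1.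
Proof. by rewrite /half_sgn; case: ifP; rewrite ?normrN ger0_norm. Qed.

Lemma bmf_half_sgn : bmf half_sgn.
Proof.
split; last by exists 2^-1 => z; rewrite normr_half_sgn.
by apply: measurable_fun_ifT => //; exact: measurable_fun_ler.
Qed.

Definition antider s g := foldr (edge_op half_sgn) g s.

Lemma bmf_antider s g : bmf g -> bmf (antider s g).
Proof.
by move=> bg; elim: s => //= i s IH; apply: bmf_edge_op => //; exact: bmf_half_sgn.
Qed.

(** Antiderivatives in other coordinates preserve mean zero in coordinate i, so
    that the integration by parts can be repeated. *)
Lemma Pi_antider s g i : bmf g -> i \notin s ->
  Pi_ a b i g = (fun=> 0) -> Pi_ a b i (antider s g) = fun=> 0.
Proof.
move=> bg + Pi0; elim: s => //= j s IH; rewrite inE negb_or => /andP[ij /IH is0].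
by apply: Pi_edge_op0 => //; [exact: bmf_half_sgn|exact: bmf_antider].
Qed.

Definition edge_ints s g := foldr (edge_int a b) g s.

Lemma bmf_edge_ints s g : bmf g -> bmf (edge_ints s g).
Proof. by move=> bg; elim: s => //= i s; exact: bmf_edge_int. Qed.

Lemma antider_le s g x : bmf g ->
  `|antider s g x| <= 2 ^- size s * edge_ints s (fun y => `|g y|) x.
Proof.
move=> bg; elim: s x => [|i s IH] x /=; first by rewrite expr0 invr1 mul1r.
have bT := bmf_antider s bg; have bN := bmf_edge_ints s (bmf_normr bg).
rewrite exprS invfM (le_trans (le_normr_Rintegral _ _))//.
  by apply: edge_op_itg => //; exact: bmf_half_sgn.
rewrite /edge_int -RintegralZl//; last exact: edge_int_itg.
apply: le_Rintegral => //.
- apply/edge_integrable/bmf_normr/bmfM; last exact: bmf_slice1.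
  exact: (bmf_comp (measurable_pair1 _) bmf_half_sgn).
- by apply/edge_integrable/bmfM; [exact: bmf_cst|exact: bmf_slice1].
- by move=> t _; rewrite normrM normr_half_sgn -mulrA ler_pM2l// IH.
Qed.

End edge_operators.

(** * Integration by parts in one coordinate *)

Section by_parts.
Context {R : realType}.
Variables (al be : R) (G g : R -> R).
Hypothesis albe : al < be.
Local Notation lam := (@lebesgue_measure R).
Local Notation J := `[al, be]%classic.
Hypothesis cg : {within J, continuous g}.
Hypothesis dG : derivable_oo_LRcontinuous G al be.
Hypothesis Gg : {in `]al, be[, G^`()%classic =1 g}.

Let lamJ : (lam J < +oo)%E.
Proof. by rewrite lebesgue_measure_itv/= lte_fin albe -EFinB ltry. Qed.

Lemma FTC_prefix t : al <= t <= be -> \int[lam]_(x in `[al, t]) g x = G t - G al.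
Proof.
move=> /andP[]; rewrite le_eqVlt => /predU1P[<- _|alt tbe].
  by rewrite set_itv1 Rintegral_set1 subrr.
have sub : `[al, t]%classic `<=` J.
  by move=> x; rewrite /= !in_itv/= => /andP[-> xt]/=; exact: le_trans tbe.
have /continuous_within_itvP := continuous_subspaceW sub
    (derivable_oo_LRcontinuous_within dG).
move=> /(_ alt)[_ Gal Gt].
rewrite /Rintegral (continuous_FTC2 alt (F := G))//.
- exact: continuous_subspaceW cg.
- split=> // x xt; have [dGx _ _] := dG; apply: dGx.
  by move: xt; rewrite !in_itv/= => /andP[-> xt]/=; exact: lt_le_trans tbe.
- move=> x xt; apply: Gg.
  by move: xt; rewrite !in_itv/= => /andP[-> xt]/=; exact: lt_le_trans tbe.
Qed.

Variables (p G1 g1 : measurableTypeR R -> R).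
Hypotheses (bp : bmf p) (bG1 : bmf G1) (bg1 : bmf g1).
Hypotheses (GG1 : forall t, J t -> G1 t = G t) (gg1 : forall t, J t -> g1 t = g t).
Hypothesis p0 : \int[lam]_(t in J) p t = 0.

Let iJ h : bmf h -> lam.-integrable J (EFin \o h).
Proof. by apply: bmf_integrable => //; exact: measurable_itv. Qed.

Let bhs1 t : bmf (fun tau : measurableTypeR R => half_sgn (tau, t)).
Proof. exact: (bmf_comp (measurable_pair2 (t : measurableTypeR R)) bmf_half_sgn). Qed.

Let bhs2 tau : bmf (fun t : measurableTypeR R => half_sgn (tau, t)).
Proof. exact: (bmf_comp (measurable_pair1 (tau : measurableTypeR R)) bmf_half_sgn). Qed.

(** By the fundamental theorem of calculus this is half of
    (G be - G t) - (G t - G al). *)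
Let hs_int t : J t ->
  \int[lam]_(tau in J) (half_sgn (tau, t) * g1 tau) = 2^-1 * (G al + G be) - G1 t.
Proof.
move=> Jt; have /andP[alt tbe] : al <= t <= be by move: Jt; rewrite /= in_itv.
have iq : lam.-integrable J (EFin \o (fun tau => half_sgn (tau, t) * g1 tau)).
  exact/iJ/bmfM.
have ig := iJ bg1.
have intg u : al <= u <= be -> \int[lam]_(x in `[al, u]) g1 x = G u - G al.
  move=> /[dup] alu /FTC_prefix <-; apply: eq_Rintegral => x; rewrite inE => xu.
  apply: gg1; move: xu alu; rewrite /= !in_itv/= => /andP[-> xu] /andP[_].
  exact: le_trans xu.
have sub : `[al, t]%classic `<=` J.
  by move=> x; rewrite /= !in_itv/= => /andP[-> xt]/=; exact: le_trans tbe.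
have sub' : `[al, t[%classic `<=` J.
  by move=> x; rewrite /= !in_itv/= => /andP[-> xt]/=; rewrite ltW// (lt_le_trans xt).
have sub2 : `]t, be]%classic `<=` J.
  by move=> x; rewrite /= !in_itv/= => /andP[tx ->]; rewrite andbT ltW//
      (le_lt_trans alt).
have aBt : (BLeft al <= BRight t)%O by rewrite bnd_simp.
have tBb : (BRight t <= BRight be)%O by rewrite bnd_simp.
have /eqP := Rintegral_itvB iq aBt tBb; rewrite subr_eq => /eqP ->.
have iS (A : set R) h : measurable A -> A `<=` J -> bmf h -> lam.-integrable A
    (EFin \o h).
  by move=> mA AJ /iJ; apply: integrableS => //; exact: measurable_itv.
rewrite -[X in _ + X]Rintegral_itv_bndo_bndc; last first.
  by apply: iS => //; exact: bmfM.
have -> : \int[lam]_(x in `]t, be]) (half_sgn (x, t) * g1 x) =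
    2^-1 * \int[lam]_(x in `]t, be]) g1 x.
  rewrite -RintegralZl//; last exact: iS.
  apply: eq_Rintegral => x; rewrite inE /= in_itv/= => /andP[tx _].
  by rewrite /half_sgn/= ltW.
have -> : \int[lam]_(x in `[al, t[) (half_sgn (x, t) * g1 x) =
    - 2^-1 * \int[lam]_(x in `[al, t[) g1 x.
  rewrite -RintegralZl//; last exact: iS.
  apply: eq_Rintegral => x; rewrite inE /= in_itv/= => /andP[_ xt].
  by rewrite /half_sgn/= leNgt xt.
rewrite Rintegral_itv_bndo_bndc; last exact: iS.
rewrite -(Rintegral_itvB ig aBt tBb) !intg ?alt// ?lexx ?(ltW albe)// GG1//.
by field.
Qed.

(** Exchange the two integrals on the right: the inner one represents [G] up to
    sign and up to a constant, which [p] does not see. *)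
Lemma half_sgn_by_parts : \int[lam]_(t in J) (p t * G1 t) =
  - \int[lam]_(tau in J)
      ((\int[lam]_(t in J) (half_sgn (tau, t) * p t)) * g1 tau).
Proof.
pose F (z : measurableTypeR R * measurableTypeR R) :=
  half_sgn z * p z.2 * g1 z.1.
have bF : bmf F.
  apply: bmfM; last exact: (bmf_comp measurable_fst bg1).
  by apply: bmfM; [exact: bmf_half_sgn|exact: (bmf_comp measurable_snd bp)].
have -> : \int[lam]_(tau in J)
      ((\int[lam]_(t in J) (half_sgn (tau, t) * p t)) * g1 tau) =
   \int[lam]_(tau in J) \int[lam]_(t in J) F (tau, t).
  apply: eq_Rintegral => tau _; rewrite /F/= RintegralZr//.
  exact/iJ/bmfM.
rewrite (@bmf_Fubini _ _ _ _ _ lam lam J J)//.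
have -> : \int[lam]_(t in J) \int[lam]_(tau in J) F (tau, t) =
  \int[lam]_(t in J) (2^-1 * (G al + G be) * p t - p t * G1 t).
  apply: eq_Rintegral => t; rewrite inE => Jt.
  transitivity (p t * \int[lam]_(tau in J) (half_sgn (tau, t) * g1 tau)).
    rewrite -RintegralZl//; last exact/iJ/bmfM.
    by apply: eq_Rintegral => tau _; rewrite /F/=; ring.
  by rewrite hs_int//; ring.
rewrite RintegralB//; last 2 first.
- by apply/iJ/bmfM => //; exact: bmf_cst.
- exact/iJ/bmfM.
rewrite RintegralZl//; last exact: iJ.
by rewrite p0 mulr0 sub0r opprK.
Qed.

End by_parts.

Section slices.
Context {R : realType} {n : nat}.
Variables (a b : 'rV[R]_n).
Hypothesis ab : forall i, a ord0 i < b ord0 i.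
Implicit Types (x : 'rV[R]_n) (i j : 'I_n) (g h gam psi : 'rV[R]_n -> R).
Local Notation mu := (@lebesgue_rV R n).
Local Notation lam := (@lebesgue_measure R).
Local Notation edge i := `[a ord0 i, b ord0 i]%classic.

Lemma set_coord_box x i t : box a b x -> edge i t -> box a b (set_coord x i t).
Proof.
move=> bx et j; have [->|ji] := eqVneq j i; first by rewrite set_coordE; move:
    et; rewrite /= in_itv.
by rewrite set_coord_neq.
Qed.

Lemma set_coord_obox x i t : obox a b x -> `]a ord0 i, b ord0 i[%classic t ->
  obox a b (set_coord x i t).
Proof.
move=> bx et j; have [->|ji] := eqVneq j i; first by rewrite set_coordE.
by rewrite set_coord_neq//; exact: bx.
Qed.

Lemma set_coord_shift x i s t :
  set_coord x i (s + t) = s *: delta_mx ord0 i + set_coord x i t.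
Proof.
apply/rowP => j; rewrite !mxE eqxx/=; case: eqP => _; rewrite ?mulr1//.
by rewrite mulr0 add0r.
Qed.

Lemma set_coord_continuous x i : continuous (set_coord x i).
Proof.
have -> : set_coord x i = fun t => t *: delta_mx ord0 i + set_coord x i 0.
  by apply/funext => t; rewrite -set_coord_shift addr0.
by move=> t; apply: cvgD; [apply: cvgZr_tmp; exact: cvg_id|exact: cvg_cst].
Qed.

Lemma is_derive_slice gam x i t v :
  is_derive (set_coord x i t) (delta_mx ord0 i) gam v ->
  is_derive t 1 (fun s => gam (set_coord x i s)) v.
Proof.
have E : (fun h : R => h^-1 *: (((fun s => gam (set_coord x i s)) \o shift t) (h
    *: 1) - gam (set_coord x i t))) =
   (fun h : R => h^-1 *: ((gam \o shift (set_coord x i t)) (h *: delta_mx ord0 i)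
       - gam (set_coord x i t))).
  by apply/funext => h /=; rewrite -set_coord_shift [h *: 1]mulr1.
by move=> [dg <-]; split; rewrite /derivable /derive E.
Qed.

(** The hypothesis of the fundamental theorem of calculus on all lines in
    direction i: differentiability is required in the interior only. *)
Definition pd_pair i gam (gam' : 'rV[R]_n -> R) := [/\ {within box a b, continuous gam},
  {within box a b, continuous gam'} &
  forall y, obox a b y -> is_derive y (delta_mx ord0 i) gam (gam' y)].

Lemma within_slice gam x i : box a b x -> {within box a b, continuous gam} ->
  {within edge i, continuous (fun t => gam (set_coord x i t))}.
Proof.
move=> bx /subspace_continuousP cg; apply/subspace_continuousP => t et.
apply: cvg_trans (cg _ (set_coord_box bx et)) => A /=.
move=> h; have {}h : nbhs t (fun s => box a b (set_coord x i s) -> A (gam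
    (set_coord x i s))).
  exact: (@set_coord_continuous x i t _ h).
change (nbhs t (fun s => edge i s -> A (gam (set_coord x i s)))).
by apply: filterS h => s + es; apply; exact: set_coord_box.
Qed.

Lemma pd_pair_slice gam gam' x i : pd_pair i gam gam' -> obox a b x ->
  let G t := gam (set_coord x i t) in
  let g t := gam' (set_coord x i t) in
  [/\ {within edge i, continuous g},
     derivable_oo_LRcontinuous G (a ord0 i) (b ord0 i) &
     {in `]a ord0 i, b ord0 i[, G^`()%classic =1 g}].
Proof.
move=> [cg cg' dg] ox G g; have bx := obox_sub_box ox.
have dG t : t \in `]a ord0 i, b ord0 i[ -> is_derive t 1 G (g t).
  by move=> tab; apply/is_derive_slice/dg/set_coord_obox.
split; first exact: within_slice.
  have /(continuous_within_itvP _ (ab i))[_ Ga Gb] := @within_slice _ _ i bx cg.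
  by split => // t /dG [].
by move=> t /dG[_ tG]; rewrite derive1E.
Qed.

Lemma int_box_obox h : bmf h ->
  \int[mu]_(x in box a b) h x = \int[mu]_(x in obox a b) h x.
Proof.
move=> bh; congr fine; have mb := measurable_box a b; have mo := measurable_obox a b.
rewrite (@negligible_integral _ _ _ _ (box a b) (box a b `\` obox a b))//.
- by rewrite setDD setIidr//; exact: obox_sub_box.
- exact: measurableD.
- by apply: bmf_integrable => //; exact: lebesgue_box_fin.
- exact: lebesgue_box_boundary.
Qed.

Lemma bmf_patch_box gam : {within box a b, continuous gam} -> bmf (gam \_ (box a b)).
Proof.
move=> cg; have mb := measurable_box a b; apply: bmf_patch => //.
- exact: within_continuous_measurable.
- exact: within_box_bounded.
Qed.

(** By averaging it suffices to integrate by parts along the lines in direction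
    i that meet the interior. *)
Lemma int_box_by_parts gam gam' psi i : pd_pair i gam gam' -> bmf psi ->
  Pi_ a b i psi = (fun=> 0) ->
  \int[mu]_(x in box a b) (psi x * (gam \_ (box a b)) x) =
  - \int[mu]_(x in box a b) (edge_op a b half_sgn i psi x * (gam' \_ (box a b)) x).
Proof.
move=> pg bpsi Pi0; have [cg cg' _] := pg.
have bg := bmf_patch_box cg; have bg' := bmf_patch_box cg'.
have bT := bmf_edge_op ab i bmf_half_sgn bpsi.
have c0 : b ord0 i - a ord0 i != 0 by rewrite subr_eq0 gt_eqF.
apply: (mulfI c0); rewrite mulrN -!int_box_edge_int//; [|exact: bmfM|exact: bmfM].
rewrite !int_box_obox; [|by apply: bmf_edge_int => //; exact: bmfM ..].
rewrite -mulN1r -RintegralZl//; last 2 first.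
- exact: measurable_obox.
- apply: bmf_integrable; [exact: measurable_obox|exact: lebesgue_obox_fin|].
  by apply: bmf_edge_int => //; exact: bmfM.
apply: eq_Rintegral => x; rewrite inE => ox; rewrite mulN1r.
have bx := obox_sub_box ox.
have [cs ds Ds] := pd_pair_slice pg ox.
have := @half_sgn_by_parts _ _ _ _ _ (ab i) cs ds Ds
  (fun t => psi (set_coord x i t)) (fun t => (gam \_ (box a b)) (set_coord x i t))
  (fun t => (gam' \_ (box a b)) (set_coord x i t)).
have patchE0 (h : 'rV[R]_n -> R) t : edge i t -> (h \_ (box a b)) (set_coord x i
    t) = h (set_coord x i t).
  by move=> et; rewrite patchE mem_set//; exact: set_coord_box.
rewrite /edge_int => ->.
- congr (- _); apply: eq_Rintegral => t _; rewrite /edge_op set_coordE; congr (_ * _).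
  by apply: eq_Rintegral => s _; rewrite set_coord_set.
- exact: bmf_slice1.
- exact: bmf_slice1.
- exact: bmf_slice1.
- exact: patchE0.
- exact: patchE0.
- have := congr1 (fun f => f x) Pi0; rewrite /Pi_ => /eqP; rewrite mulf_eq0.
  by rewrite invr_eq0 (negbTE c0)/= => /eqP.
Qed.

End slices.

(** * Iterated integration by parts *)

Section iterated_by_parts.
Context {R : realType} {n : nat}.
Variables (a b : 'rV[R]_n).
Hypothesis ab : forall i, a ord0 i < b ord0 i.
Implicit Types (x : 'rV[R]_n) (i j : 'I_n) (f gam psi : 'rV[R]_n -> R).
Implicit Types (s : seq 'I_n).
Local Notation mu := (@lebesgue_rV R n).

Definition pds_extension s f gam := {within box a b, continuous gam} /\
  forall x, obox a b x -> pds s f x = gam x.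

Lemma pds_extension_ex k f s : Ck_closure k (box a b) f -> (size s <= k)%N ->
  exists gam, pds_extension s f gam.
Proof.
by case=> _ _ + sk => /(_ s sk)[gam [cg Eg]]; exists gam; split=> // x; rewrite
    -interior_box => /Eg.
Qed.

Lemma open_obox : open (obox a b).
Proof. by rewrite -interior_box; exact: open_interior. Qed.

Lemma pds_extension_pair k f s i gam (gam' : 'rV[R]_n -> R) :
  Ck_closure k (box a b) f -> (size s < k)%N ->
  pds_extension s f gam -> pds_extension (i :: s) f gam' ->
  pd_pair a b i gam gam'.
Proof.
move=> [_ df _] sk [cg Eg] [cg' Eg']; split => // y oy.
rewrite -Eg'//; apply: (@near_eq_is_derive _ _ _ (pds s f)).
- by near=> z; apply: Eg; near: z; apply: open_nbhs_nbhs; split; [exact: open_obox|].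
- have := df s sk i y; rewrite interior_box => /(_ oy) dy.
  by split.
Unshelve. all: by end_near. Qed.

(** The sign of each integration by parts is absorbed by the absolute value. *)
Lemma int_box_antider k f s psi gam : Ck_closure k (box a b) f ->
  (size s <= k)%N -> uniq s -> bmf psi ->
  (forall i, i \in s -> Pi_ a b i psi = (fun=> 0)) ->
  pds_extension s f gam ->
  `|\int[mu]_(x in box a b) (psi x * (f \_ (box a b)) x)| =
  `|\int[mu]_(x in box a b) (antider a b s psi x * (gam \_ (box a b)) x)|.
Proof.
move=> fk + + bpsi; have bf : bmf (f \_ (box a b)) by case: fk => /bmf_patch_box.
elim: s gam => [|i s IH] gam /= sk us Pi0 sg.
  have [cg Eg] := sg; have bg := bmf_patch_box cg.
  rewrite !int_box_obox//; [|exact: bmfM|exact: bmfM].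
  congr `| _ |; apply: eq_Rintegral => x; rewrite inE => ox.
  by have := Eg x ox; rewrite !patchE => <-.
have [gam' sg'] := pds_extension_ex fk (ltnW sk).
have /andP[is' us'] := us.
rewrite (IH gam')//; [|exact: ltnW|by move=> j js; apply: Pi0; rewrite inE js orbT].
rewrite (int_box_by_parts ab (pds_extension_pair fk sk sg' sg)) ?normrN//.
  exact: bmf_antider.
by apply: Pi_antider => //; apply: Pi0; rewrite inE eqxx.
Qed.

Lemma int_box_antider_le k f s psi gam : Ck_closure k (box a b) f ->
  (size s <= k)%N -> uniq s -> bmf psi ->
  (forall i, i \in s -> Pi_ a b i psi = (fun=> 0)) ->
  pds_extension s f gam ->
  `|\int[mu]_(x in box a b) (psi x * (f \_ (box a b)) x)| <=
  2 ^- size s * \int[mu]_(x in box a b)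
    (edge_ints a b s (fun y => `|psi y|) x * `|(gam \_ (box a b)) x|).
Proof.
move=> fk sk us bpsi Pi0 sg; rewrite (int_box_antider fk sk us bpsi Pi0 sg).
have [cg _] := sg; have bg := bmf_patch_box cg.
have mb := measurable_box a b; have fb := lebesgue_box_fin ab.
have bT := bmf_antider ab s bpsi.
have bN := bmf_edge_ints ab s (bmf_normr bpsi).
rewrite (le_trans (le_normr_Rintegral _ _))//; first exact/bmf_integrable/bmfM.
rewrite -RintegralZl//; last exact/bmf_integrable/bmfM/bmf_normr.
apply: le_Rintegral => //.
- exact/bmf_integrable/bmf_normr/bmfM.
- by apply/bmf_integrable/bmfM => //; [exact: bmf_cst|exact/bmfM/bmf_normr].
- by move=> x _; rewrite normrM mulrA ler_wpM2r// antider_le.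
Qed.

End iterated_by_parts.

(** * Splitting the coordinates *)

Section coordinate_restriction.
Context {R : realType} {n : nat}.
Implicit Types (x : 'rV[R]_n) (i j : 'I_n) (I : {set 'I_n}).

Lemma pick_enum_val I (k : 'I_#|I|) :
  [pick k' : 'I_#|I| | enum_val k' == enum_val k] = Some k.
Proof. by case: pickP => [k' /eqP/enum_val_inj ->//|/(_ k)]; rewrite eqxx. Qed.

Lemma pick_enum_val_out I i : i \notin I ->
  [pick k : 'I_#|I| | enum_val k == i] = None.
Proof.
move=> iI; case: pickP => [k /eqP ki|//].
by move: iI; rewrite -ki enum_valP.
Qed.

Lemma map_enum_val I : map (@enum_val _ (mem I)) (enum 'I_#|I|) = enum I.
Proof.
have sz : size [seq enum_val k | k <- enum 'I_#|I|] = size (enum I).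
  by rewrite size_map size_enum_ord cardE.
case E : (enum I) => [|x0 s0].
  by apply/size0nil; rewrite sz E.
rewrite -E; apply: (@eq_from_nth _ x0) => // k; rewrite size_map => kI.
have kI' : (k < #|I|)%N by rewrite size_enum_ord in kI.
by rewrite (nth_map (Ordinal kI'))// (enum_val_nth x0) nth_enum_ord.
Qed.

Lemma restr_coord_set x I (k : 'I_#|I|) t :
  restr_coord I (set_coord x (enum_val k) t) = set_coord (restr_coord I x) k t.
Proof. by apply/rowP => l; rewrite !mxE (inj_eq enum_val_inj). Qed.

Lemma restr_coord_set_out x I i t : i \notin I ->
  restr_coord I (set_coord x i t) = restr_coord I x.
Proof.
move=> iI; apply/rowP => l; rewrite !mxE; case: eqP => // E.
by move: iI; rewrite -E enum_valP.
Qed.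

Lemma coord_at_restr x I i : i \in I -> coord_at (restr_coord I x) i = x ord0 i.
Proof.
move=> iI; rewrite -(enum_rankK_in iI iI) /coord_at pick_enum_val mxE.
by [].
Qed.

Lemma glue_restr x I : glue_coord (restr_coord (~: I) x) (restr_coord I x) = x.
Proof.
apply/rowP => i; rewrite mxE; case: ifPn => iI; rewrite coord_at_restr//.
by rewrite inE.
Qed.

Lemma coord_at_enum_val I (v : 'rV[R]_#|I|) k : coord_at v (enum_val k) = v ord0 k.
Proof. by rewrite /coord_at pick_enum_val. Qed.

Lemma glue_set_coord x i t :
  @glue_coord _ _ [set i]%SET (restr_coord (~: [set i]) x) (const_mx t) = set_coord x i t.
Proof.
apply/rowP => j; rewrite !mxE inE; case: eqP => [->|/eqP ji].
  rewrite /coord_at; case: pickP => [k _|/(_ (enum_rank_in (set11 i) i))]; first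
      by rewrite mxE.
  by rewrite enum_rankK_in ?eqxx// set11.
by rewrite coord_at_restr// !inE.
Qed.

Lemma measurable_glue I (u : 'rV[R]_#|~: I|) :
  measurable_fun setT (glue_coord u : 'rV[R]_#|I| -> 'rV[R]_n).
Proof.
apply: measurable_fun_coord => i; have [iI|iI] := boolP (i \in I); last first.
  by under eq_fun do rewrite mxE (negbTE iI); exact: measurable_cst.
rewrite -(enum_rankK_in iI iI); under eq_fun do rewrite mxE enum_valP coord_at_enum_val.
exact: measurable_coord.
Qed.

Lemma measurable_restr I : measurable_fun setT (restr_coord I : 'rV[R]_n -> 'rV[R]_#|I|).
Proof.
apply: measurable_fun_coord => k; under eq_fun do rewrite mxE.
exact: measurable_coord.
Qed.

End coordinate_restriction.

Section iterated_edge_integrals.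
Context {R : realType}.

Section all_coordinates.
Context {n : nat}.
Variables (a b : 'rV[R]_n).
Hypothesis ab : forall i, a ord0 i < b ord0 i.
Implicit Types (x y : 'rV[R]_n) (i j : 'I_n) (h : 'rV[R]_n -> R) (s : seq 'I_n).
Local Notation mu := (@lebesgue_rV R n).

(** The coordinates in [s] are integrated out. *)
Lemma edge_ints_local s h x y : (forall j, j \notin s -> x ord0 j = y ord0 j) ->
  edge_ints a b s h x = edge_ints a b s h y.
Proof.
elim: s x y => [|i s IH] x y xy /=.
  by congr h; apply/rowP => j; exact: xy.
apply: eq_Rintegral => t _; apply: IH => j js.
have [->|ji] := eqVneq j i; first by rewrite !set_coordE.
by rewrite !set_coord_neq//; apply: xy; rewrite inE negb_or ji.
Qed.

Lemma int_box_edge_ints s h : bmf h -> \int[mu]_(x in box a b) edge_ints a b s h x =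
  (\prod_(i <- s) (b ord0 i - a ord0 i)) * \int[mu]_(x in box a b) h x.
Proof.
move=> bh; elim: s => [|i s IH] /=; first by rewrite big_nil mul1r.
by rewrite big_cons int_box_edge_int ?IH ?mulrA//; exact: bmf_edge_ints.
Qed.

(** Integrating out all coordinates leaves a constant function, whose value is
    read off from its integral over the box. *)
Lemma edge_ints_enum h x : bmf h ->
  edge_ints a b (enum 'I_n) h x = \int[mu]_(y in box a b) h y.
Proof.
move=> bh; set c := edge_ints _ _ _ _ _.
have V0 : \prod_i (b ord0 i - a ord0 i) != 0.
  by apply/prodf_neq0 => i _; rewrite subr_eq0 gt_eqF.
apply: (mulfI V0); have := int_box_edge_ints (enum 'I_n) bh.
rewrite big_enum => <-.
have -> : \int[mu]_(y in box a b) edge_ints a b (enum 'I_n) h y =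
    \int[mu]_(y in box a b) c.
  by apply: eq_Rintegral => y _; apply: edge_ints_local => j; rewrite mem_enum.
rewrite Rintegral_cst; last exact: measurable_box.
by rewrite mulrC; congr (_ * _); have /= -> := lebesgue_rV_box ab.
Qed.

End all_coordinates.

Context {n : nat}.
Variables (a b : 'rV[R]_n).
Hypothesis ab : forall i, a ord0 i < b ord0 i.
Implicit Types (x y : 'rV[R]_n) (i j : 'I_n) (h : 'rV[R]_n -> R) (I : {set 'I_n}).
Local Notation mu := (@lebesgue_rV R n).

Lemma restr_coord_lt I k : restr_coord I a ord0 k < restr_coord I b ord0 k.
Proof. by rewrite !mxE. Qed.

Lemma glue_box I x t : box a b x -> box (restr_coord I a) (restr_coord I b) t ->
  box a b (glue_coord (restr_coord (~: I) x) t).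
Proof.
move=> bx bt i; rewrite mxE; case: ifPn => iI; last first.
  by rewrite coord_at_restr// inE.
by rewrite -(enum_rankK_in iI iI) coord_at_enum_val; have := bt (enum_rank_in iI
    i); rewrite !mxE.
Qed.

(** Integrating out coordinates of I in R^n is the same as doing it in R^I with
    the other coordinates frozen. *)
Lemma edge_ints_glue I (s : seq 'I_#|I|) h x :
  edge_ints a b (map (@enum_val _ (mem I)) s) h x =
  edge_ints (restr_coord I a) (restr_coord I b) s
    (fun t => h (glue_coord (restr_coord (~: I) x) t)) (restr_coord I x).
Proof.
elim: s x => [|k s IH] x /=; first by rewrite glue_restr.
rewrite /edge_int !mxE; apply: eq_Rintegral => t _; rewrite IH.
by rewrite restr_coord_set restr_coord_set_out// inE negbK enum_valP.
Qed.

Lemma bmf_glue I h u : bmf h ->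
  bmf (fun t : 'rV[R]_#|I| => h (glue_coord u t)).
Proof. by apply: bmf_comp; exact: measurable_glue. Qed.

Lemma edge_ints_box I h x : bmf h -> edge_ints a b (enum I) h x =
  \int[lebesgue_rV #|I|]_(t in box (restr_coord I a) (restr_coord I b))
    h (glue_coord (restr_coord (~: I) x) t).
Proof.
move=> bh; rewrite -map_enum_val edge_ints_glue edge_ints_enum//.
  by move=> k; exact: restr_coord_lt.
exact: bmf_glue.
Qed.

Local Open Scope ereal_scope.

(** The projection of the uniform measure of the box to R^I is a multiple of the
    uniform measure of the projected box; in particular null sets of R^I pull
    back to null sets. *)
Lemma restr_pushforward I (Z : set 'rV[R]_#|I|) : measurable Z ->
  mu (box a b `&` restr_coord I @^-1` Z) =
  (\prod_(i in ~: I) (b ord0 i - a ord0 i))%:E *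
  lebesgue_box (restr_coord I a) (restr_coord I b) Z.
Proof.
move=> mZ; have mb := measurable_box a b.
have c0 : (0 <= \prod_(i in ~: I) (b ord0 i - a ord0 i))%R.
  by apply: prodr_ge0 => i _; rewrite subr_ge0 ltW.
pose m1 := measure_function_pushforward__canonical__measure_function_Measure
   (mrestr mu mb) (@measurable_restr R n I).
pose m2 := mscale (NngNum c0) (lebesgue_box (restr_coord I a) (restr_coord I b)).
have m1E B : m1 B = mu (box a b `&` restr_coord I @^-1` B) by rewrite setIC.
rewrite -m1E; suff : m1 Z = m2 Z by [].
have m12 (c e : 'rV[R]_#|I|) : m1 (obox c e) = m2 (obox c e).
  (* The preimage of the open box is a rectangle that restricts only the
     coordinates in I. *)
  pose A i := if [pick k : 'I_#|I| | enum_val k == i] is Some k then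
    `]c ord0 k, e ord0 k[%classic else setT.
  have mA i : measurable (`[a ord0 i, b ord0 i]%classic `&` A i).
    apply: measurableI; first exact: measurable_itv.
    by rewrite /A; case: pickP => [k _|_]; [exact: measurable_itv|exact: measurableT].
  have -> : m1 (obox c e) = mu (rect (fun i => `[a ord0 i, b ord0 i]%classic `&` A i)).
    rewrite m1E boxE; congr (mu _); apply/seteqP; split=> x.
      move=> [xab xce] i; split; first exact: xab.
      rewrite /A; case: pickP => // k /eqP ki.
      by have := xce k; rewrite /= mxE ki.
    move=> xA; split => [i|k]; first by have [] := xA i.
    by have [_] := xA (enum_val k); rewrite /A pick_enum_val mxE.
  have -> : m2 (obox c e) = (\prod_(i in ~: I) (b ord0 i - a ord0 i))%:E *
      lebesgue_rV #|I| (rect (fun k => `[a ord0 (enum_val k), b ord0 (enum_val k)]%classic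
         `&` `]c ord0 k, e ord0 k[%classic)).
    rewrite /m2 /mscale/= /lebesgue_box/= /mrestr setIC; congr (_ * lebesgue_rV _ _).
    rewrite boxE; apply/seteqP; split=> [x [h k] j|x h].
      by split; [have := h j; rewrite /= !mxE|exact: k].
    by split => j; have [] := h j; rewrite /= ?mxE.
  rewrite (lebesgue_rV_rect mA) lebesgue_rV_rect; last first.
    by move=> k; apply: measurableI; exact: measurable_itv.
  rewrite (bigID (mem I))/= muleC; congr (_ * _).
    rewrite -prodEFin (eq_bigl (mem (~: I))); last by move=> i; rewrite !inE.
    apply: eq_bigr => i iI; rewrite /A pick_enum_val_out.
      by rewrite setIT; exact: lebesgue_edge.
    by rewrite !inE in iI.
  rewrite big_enum_val; apply: eq_bigr => k _.
  by rewrite /A pick_enum_val.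
apply: obox_measure_unique => // c e.
rewrite m1E (le_lt_trans _ (lebesgue_box_fin ab))// le_measure ?inE//.
apply: measurableI => //; rewrite -[X in measurable X]setTI.
by apply: measurable_restr => //; exact: measurable_obox.
Qed.

End iterated_edge_integrals.

(** * Null sets and their slices *)

Section almost_everywhere.
Context {R : realType} {n : nat}.
Variables (a b : 'rV[R]_n).
Hypothesis ab : forall i, a ord0 i < b ord0 i.
Implicit Types (x : 'rV[R]_n) (i j : 'I_n) (psi chi : 'rV[R]_n -> R) (I : {set 'I_n}).
Implicit Types (P : 'rV[R]_n -> Prop) (s : seq 'I_n).
Local Notation mu := (@lebesgue_rV R n).
Local Notation lam := (@lebesgue_measure R).
Local Notation edge i := `[a ord0 i, b ord0 i]%classic.
Local Notation boxI I := (box (restr_coord I a) (restr_coord I b)).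
Local Notation ae_box P := (\forall x \ae lebesgue_box a b, box a b x -> P x).

Lemma bmf_indic (N : set 'rV[R]_n) : measurable N -> bmf (\1_N : 'rV[R]_n -> R).
Proof.
move=> mN; split; first exact: measurable_indic.
by exists 1 => x; rewrite indicE ger0_norm; case: (_ \in _).
Qed.

Lemma edge_ints_ge0 s psi x : (forall y, 0 <= psi y) -> 0 <= edge_ints a b s psi x.
Proof.
move=> p0; elim: s x => [|i s IH] x //=; rewrite /edge_int.
by apply: Rintegral_ge0 => t _; exact: IH.
Qed.

(** A nonnegative function whose integral vanishes; the integral is known by
    averaging. *)
Lemma ae_box_edge_ints0 s (N : set 'rV[R]_n) : measurable N -> mu (N `&` box a b) = 0%E ->
  ae_box (fun x => edge_ints a b s \1_N x = 0).
Proof.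
move=> mN N0; have bN := bmf_indic mN; have mb := measurable_box a b.
have fb := lebesgue_box_fin ab; have bE := bmf_edge_ints ab s bN.
have E0 : (\int[mu]_(x in box a b) `|(edge_ints a b s \1_N x)%:E| = 0)%E.
  under eq_integral => x _.
    rewrite gee0_abs ?lee_fin; last by apply: edge_ints_ge0 => y; rewrite indicE.
    over.
  rewrite -(EFin_bmf_int mb fb bE).
  rewrite int_box_edge_ints// /Rintegral integral_indic//. have /= -> := N0;
      rewrite mulr0.
  by [].
have mE : measurable_fun (box a b) (EFin \o edge_ints a b s \1_N).
  by apply/measurable_EFinP; apply: measurable_funTS; case: bE.
have [+ _] := ae_eq_integral_abs mu mb mE.
move=> /(_ E0)[Z [mZ Z0 sub]]; exists Z; split => //.
  by apply: (subset_measure0 _ _ _ Z0) => //; exact: measurableI.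
move=> x /= h; apply: sub => /= k; apply: h => bx.
by have := k bx => -[].
Qed.

(** For almost every position of the other coordinates, the slice of a null set
    is a null set. *)
Lemma ae_box_glue I P : ae_box P -> ae_box (fun x =>
  \forall t \ae lebesgue_rV #|I|, boxI I t -> P (glue_coord (restr_coord (~: I) x) t)).
Proof.
move=> [N [mN N0 sub]].
apply: filterS (ae_box_edge_ints0 (enum I) mN N0) => x + bx => /(_ bx).
rewrite edge_ints_box//; last exact: bmf_indic.
set u := restr_coord _ x => E0.
have mZ : measurable (glue_coord u @^-1` N).
  by rewrite -[X in measurable X]setTI; exact: measurable_glue.
have mI := measurable_box (restr_coord I a) (restr_coord I b).
exists (glue_coord u @^-1` N `&` boxI I); split; first exact: measurableI.
  rewrite -(integral_indic _ mI mZ) -(EFin_bmf_int mI).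
  - by congr EFin; rewrite -[RHS]E0.
  - by apply: lebesgue_box_fin => k; exact: restr_coord_lt.
  - exact: (bmf_glue _ (bmf_indic mN)).
move=> t /= h; have [bt|bt] := pselect (boxI I t); last by exfalso; apply: h.
split=> //; apply: sub => /= k; apply: h => _; apply: k; exact: glue_box.
Qed.

Lemma ae_box_slice i P : ae_box P -> ae_box (fun x =>
  \forall t \ae lam, edge i t -> P (set_coord x i t)).
Proof.
move=> [N [mN N0 sub]].
apply: filterS (ae_box_edge_ints0 [:: i] mN N0) => x + bx => /(_ bx) /= E0.
have mZ : measurable (set_coord x i @^-1` N).
  rewrite -[X in measurable X]setTI.
  exact: (measurableT_comp (measurable_set_coord i) (measurable_pair1 x)).
exists (set_coord x i @^-1` N `&` edge i); split.
- by apply: measurableI => //; exact: measurable_itv.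
- transitivity (\int[lam]_(t in edge i) (\1_(set_coord x i @^-1` N) t)%:E)%E.
    by rewrite integral_indic//; exact: measurable_itv.
  transitivity ((edge_int a b i \1_N x)%:E); last by rewrite E0.
  rewrite /edge_int EFin_bmf_int//.
  + exact: lebesgue_edge_fin.
  + exact: (bmf_slice1 _ _ (bmf_indic mN)).
- move=> t /= h; have [bt|bt] := pselect (edge i t); last by exfalso; apply: h.
  split=> //; apply: sub => /= k; apply: h => _; apply: k; exact: set_coord_box.
Qed.

Lemma measurable_slice i psi x : measurable_fun (box a b) psi -> box a b x ->
  measurable_fun (edge i) (fun t : measurableTypeR R => psi (set_coord x i t)).
Proof.
move=> mpsi bx; apply: (measurable_comp (measurable_box a b) _ mpsi).
  by move=> _ [t et <-]; exact: set_coord_box.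
apply: measurable_funTS.
exact: (measurableT_comp (measurable_set_coord i) (measurable_pair1 x)).
Qed.

Lemma measurable_glue_slice I psi x : measurable_fun (box a b) psi -> box a b x ->
  measurable_fun (boxI I) (fun t => psi (glue_coord (restr_coord (~: I) x) t)).
Proof.
move=> mpsi bx; apply: (measurable_comp (measurable_box a b) _ mpsi).
  by move=> _ [t et <-]; exact: glue_box.
by apply: measurable_funTS; exact: measurable_glue.
Qed.

Lemma measurable_Pi i psi : measurable_fun (box a b) psi ->
  measurable_fun (box a b) (Pi_ a b i psi).
Proof.
move=> mpsi; have mb := measurable_box a b.
apply: (eq_measurable_fun (Pi_ a b i (psi \_ (box a b)))).
  move=> x /set_mem bx; rewrite /Pi_; congr (_ * _).
  apply: eq_Rintegral => t /set_mem et; rewrite patchE mem_set//.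
  exact: set_coord_box.
apply: measurable_funTS; apply: measurable_funM; first exact: measurable_cst.
apply: (@measurable_fun_Rint _ _ _ _ _ lam _ _
  (fun z : 'rV[R]_n * measurableTypeR R => (psi \_ (box a b)) (set_coord z.1 i z.2))).
  exact: measurable_itv.
apply: measurableT_comp (measurable_set_coord i).
by have [h _] := measurable_restrictT psi mb; exact: h mpsi.
Qed.

Lemma measurable_residual s psi : measurable_fun (box a b) psi ->
  measurable_fun (box a b) (residual a b s psi).
Proof.
move=> mpsi; elim: s => //= i s IH.
by apply: measurable_funB => //; exact: measurable_Pi.
Qed.

(** Hence the operators act on classes of functions modulo null sets. *)
Lemma ae_box_Pi i psi chi : measurable_fun (box a b) psi ->
  measurable_fun (box a b) chi -> ae_box (fun x => psi x = chi x) ->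
  ae_box (fun x => Pi_ a b i psi x = Pi_ a b i chi x).
Proof.
move=> mpsi mchi /(ae_box_slice i); apply: filterS => x + bx => /(_ bx) eqx.
rewrite /Pi_; congr (_ * fine _); apply: ae_eq_integral.
- exact: measurable_itv.
- by apply/measurable_EFinP; exact: measurable_slice.
- by apply/measurable_EFinP; exact: measurable_slice.
- have [Z [mZ Z0 sub]] := eqx; exists Z; split => // t h.
  by apply: sub => /= k; apply: h => et /=; rewrite k.
Qed.

Lemma ae_box_residual s psi chi : measurable_fun (box a b) psi ->
  measurable_fun (box a b) chi -> ae_box (fun x => psi x = chi x) ->
  ae_box (fun x => residual a b s psi x = residual a b s chi x).
Proof.
move=> mpsi mchi E; elim: s => //= i s IH.
have := ae_box_Pi i (measurable_residual s mpsi) (measurable_residual s mchi) IH.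
by apply: filterS2 IH => x + + bx => /(_ bx) -> /(_ bx) ->.
Qed.

Local Open Scope ereal_scope.

Lemma ae_box_restr I (Q : 'rV[R]_#|I| -> Prop) :
  (\forall u \ae lebesgue_box (restr_coord I a) (restr_coord I b), Q u) ->
  ae_box (fun x => Q (restr_coord I x)).
Proof.
move=> [Z [mZ Z0 sub]]; exists (restr_coord I @^-1` Z); split.
- by rewrite -[X in measurable X]setTI; exact: measurable_restr.
- transitivity (mu (box a b `&` restr_coord I @^-1` Z)); first by rewrite setIC.
  by rewrite restr_pushforward// Z0 mule0.
- by move=> x /= h; apply: sub => /= k; apply: h.
Qed.

(** The essential supremum over the remaining coordinates controls, at almost
    every point of the box, the integral along the edge through that point. *)
Lemma ae_box_edge_int_le i psi chi L : measurable_fun (box a b) psi -> bmf chi ->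
  ae_box (fun x => psi x = chi x) ->
  ess_sup (lebesgue_box (restr_coord (~: [set i]%SET) a) (restr_coord (~: [set i]%SET) b))
    (fun u => \int[lam]_(t in `[a ord0 i, b ord0 i])
         `|psi (@glue_coord _ _ [set i]%SET u (const_mx t))|%:E) <= L ->
  ae_box (fun x => (edge_int a b i (fun y => `|chi y|%R) x)%:E <= L).
Proof.
move=> mpsi bchi E /ess_supP/ae_box_restr; have [mchi _] := bchi.
apply: filterS2 (ae_box_slice i E) => x + + bx => /(_ bx) eqx /(_ bx).
apply: le_trans; rewrite le_eqVlt; apply/orP; left; apply/eqP.
rewrite /edge_int EFin_bmf_int; [|exact: measurable_itv|exact: lebesgue_edge_fin|].
  apply: ae_eq_integral.
  - exact: measurable_itv.
  - apply/measurable_EFinP/measurableT_comp => //.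
    by apply: measurable_slice => //; exact: measurable_funTS.
  - apply/measurable_EFinP/measurableT_comp => //.
    apply: (eq_measurable_fun (fun t => psi (set_coord x i t))).
      by move=> t _; congr psi; exact/esym/glue_set_coord.
    exact: measurable_slice.
  - have [Z [mZ Z0 sub]] := eqx; exists Z; split => // t h.
    by apply: sub => /= k; apply: h => et /=; rewrite -k//; congr (`|psi _|%:E);
        exact/esym/glue_set_coord.
exact: (bmf_slice1 i x (bmf_normr bchi)).
Qed.

Lemma ae_box_edge_ints_le I psi chi : measurable_fun (box a b) psi -> bmf chi ->
  ae_box (fun x => psi x = chi x) ->
  ae_box (fun x => (edge_ints a b (enum I) (fun y => `|chi y|%R) x)%:E <=
     Lambda_mix a b I psi).
Proof.
move=> mpsi bchi E; have [mchi _] := bchi.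
have := ess_sup_ge (lebesgue_box (restr_coord (~: I) a) (restr_coord (~: I) b))
  (fun u => \int[lebesgue_rV #|I|]_(t in boxI I) `|psi (glue_coord u t)|%:E).
move=> /ae_box_restr.
apply: filterS2 (ae_box_glue I E) => x + + bx => /(_ bx) eqx /(_ bx).
apply: le_trans; rewrite le_eqVlt; apply/orP; left; apply/eqP.
have mI := measurable_box (restr_coord I a) (restr_coord I b).
rewrite edge_ints_box//; last exact: bmf_normr.
rewrite (EFin_bmf_int mI).
- apply: ae_eq_integral => //.
  + apply/measurable_EFinP/measurableT_comp => //.
    by apply: measurable_glue_slice => //; exact: measurable_funTS.
  + apply/measurable_EFinP/measurableT_comp => //.
    exact: measurable_glue_slice.
  + have [Z [mZ Z0 sub]] := eqx; exists Z; split => // t h.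
    by apply: sub => /= k; apply: h => et /=; rewrite k.
- by apply: lebesgue_box_fin => k; exact: restr_coord_lt.
- exact: (bmf_glue _ (bmf_normr bchi)).
Qed.

End almost_everywhere.

(** * Smooth functions built from exp(-1/s) *)

Section flat_exponential.
Context {R : realType}.
Implicit Types (p : {poly R}) (s t u : R).

(** The factor p(1/s) makes the family closed under derivation. *)
Definition flat_exp p s : R := if 0 < s then p.[s^-1] * expR (- s^-1) else 0.

Lemma horner_expR_decay p : exists C, forall u, 0 <= u ->
  `|p.[u]| * expR (- u) * u ^+ 2 <= C.
Proof.
exists (\sum_(i < size p) `|p`_i| * (i.+2)`!%:R) => u u0.
rewrite horner_coef; apply: (@le_trans _ _ ((\sum_(i < size p) `|p`_i * u ^+ i|)
    * expR (- u) * u ^+ 2)).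
  rewrite ler_wpM2r ?exprn_ge0// ler_wpM2r ?expR_ge0//.
  exact: ler_norm_sum.
rewrite -mulrA mulr_suml; apply: ler_sum => i _.
rewrite normrM (ger0_norm (exprn_ge0 _ u0)) -mulrA ler_wpM2l// mulrCA -exprD addn2.
rewrite expRN ler_pdivrMl ?expR_gt0// -ler_pdivrMr ?ltr0n ?fact_gt0//.
by apply: le_trans (expR_ge1Dxn i.+1 u0); rewrite lerDr.
Qed.

(** Quadratic flatness at 0, the only point where differentiability of
    [flat_exp] is not a matter of rules of calculus. *)
Lemma flat_exp_le p : exists C, forall s, `|flat_exp p s| <= C * s ^+ 2.
Proof.
have [C pC] := horner_expR_decay p; exists C => s; rewrite /flat_exp.
have C0 : 0 <= C by have := pC 0; rewrite expr0n mulr0; apply.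
case: ifPn => [s0|_]; last by rewrite normr0 mulr_ge0// sqr_ge0.
rewrite normrM (ger0_norm (expR_ge0 _)) -ler_pdivrMr ?exprn_gt0//.
by rewrite -exprVn pC// invr_ge0 ltW.
Qed.

Lemma is_derive_flat_exp p s :
  is_derive s 1 (flat_exp p) (flat_exp ('X^2 * (p - p^`())) s).
Proof.
have [s0|s0|->] := ltgtP s 0.
- rewrite [X in is_derive _ _ _ X]/flat_exp ltNge (ltW s0)/=.
  apply: (@near_eq_is_derive _ _ _ (cst 0)).
  by near=> z; rewrite /flat_exp ltNge ltW//; near: z; exact: lt_nbhsl.
- rewrite [X in is_derive _ _ _ X]/flat_exp s0.
  have dV : is_derive s 1 (fun z : R => z^-1) (- s ^- 2).
    have := @is_deriveV R (id : R -> R) s 1 1 (lt0r_neq0 s0) (is_derive_id _ _).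
    by move/is_derive_eq; apply; rewrite /= -[LHS]/(_ * _) mulr1.
  have dp : is_derive s 1 (fun z : R => p.[z^-1]) (p^`().[s^-1] * - s ^- 2).
    exact: (is_derive1_comp (is_derive_poly p _) dV).
  have de : is_derive s 1 (fun z : R => expR (- z^-1)) (expR (- s^-1) * (s ^- 2)).
    have := is_derive1_comp (is_derive_expR _) (is_deriveN dV).
    by rewrite opprK.
  have dd := is_deriveM dp de.
  apply: (@near_eq_is_derive _ _ _ ((fun z : R => p.[z^-1]) * (fun z : R => expR
      (- z^-1)))).
    by near=> z; rewrite /flat_exp ifT//; near: z; exact: lt_nbhsr.
  move: dd => /is_derive_eq; apply.
  rewrite !hornerE exprVn -![_ *: _]/(_ * _) /=; field.
  by rewrite gt_eqF.
rewrite [X in is_derive _ _ _ X]/flat_exp ltxx.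
have [C pC] := flat_exp_le p.
apply/is_derive1_caratheodory; exists (fun z => flat_exp p z / z); split.
- move=> z; rewrite [flat_exp p 0]/flat_exp ltxx !subr0.
  have [->|z0] := eqVneq z 0; first by rewrite /flat_exp ltxx mulr0.
  by rewrite divfK.
- rewrite /prop_for /continuous_at /= invr0 mulr0.
  have C0 : 0 < `|C| + 1 by rewrite ltr_wpDl.
  apply/cvgrPdist_le => e e0; near=> z; rewrite sub0r normrN normrM.
  have [->|z0] := eqVneq z 0; first by rewrite invr0 normr0 mulr0 ltW.
  rewrite normfV ler_pdivrMr ?normr_gt0// (le_trans (pC z))//.
  rewrite -(real_normK (num_real z)) expr2 mulrA ler_wpM2r//.
  have : `|z| < e / (`|C| + 1).
    by near: z; apply: (@nbhs0_lt R R _ (divr_gt0 e0 C0)).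
  rewrite ltr_pdivlMr// => zC; rewrite (le_trans _ (ltW zC))// mulrC ler_wpM2l//.
  by rewrite (le_trans (ler_norm _))// lerDl.
- by rewrite invr0 mulr0.
Unshelve. all: by end_near. Qed.

Definition step := flat_exp 1.

Lemma step_ge0 s : 0 <= step s.
Proof. by rewrite /step /flat_exp hornerC mul1r; case: ifP => // _; exact: expR_ge0. Qed.

Lemma step_le1 s : step s <= 1.
Proof.
rewrite /step /flat_exp hornerC mul1r; case: ifP => // s0.
by rewrite expR_le1 oppr_le0 invr_ge0 ltW.
Qed.

Lemma step_le0 s : s <= 0 -> step s = 0.
Proof. by move=> s0; rewrite /step /flat_exp ltNge s0. Qed.

Lemma step_cvg1 s : 0 < s -> step (k.+1%:R * s - 1) @[k --> \oo] --> (1 : R).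
Proof.
move=> s0; apply/cvgrPdist_le => e e0; near=> k.
set u := k.+1%:R * s - 1.
have ku : e^-1 + 1 < k.+1%:R * s.
  rewrite -ltr_pdivrMr//; near: k.
  exists (Num.bound ((e^-1 + 1) / s)) => // k /= hk.
  rewrite (lt_le_trans (archi_boundP _)) ?ler_nat ?(leq_trans hk)//.
  by rewrite divr_ge0 ?addr_ge0 ?invr_ge0// ltW.
have eu : e^-1 < u by rewrite /u ltrBrDr.
have u0 : 0 < u by apply: lt_trans eu; rewrite invr_gt0.
rewrite ger0_norm ?subr_ge0 ?step_le1//.
rewrite /step /flat_exp u0 hornerC mul1r.
have := expR_ge1Dx (- u^-1).
have : u^-1 < e by rewrite -[e]invrK ltf_pV2 ?posrE ?invr_gt0.
lra.
Unshelve. all: by end_near. Qed.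

Lemma flat_exp_continuous p : continuous (flat_exp p).
Proof.
move=> s; apply/differentiable_continuous/derivable1_diffP.
by have [] := is_derive_flat_exp p s.
Qed.

End flat_exponential.

Section smooth_functions.
Context {R : realType} {n : nat}.
Implicit Types (x : 'rV[R]_n) (i j : 'I_n) (psi : 'rV[R]_n -> R).

(** Being closed under partial derivatives, this class consists of smooth
    functions; an induction on its constructors replaces any theory of
    higher derivatives. *)
Inductive flat_smooth : ('rV[R]_n -> R) -> Prop :=
| flat_smooth_cst c : flat_smooth (cst c)
| flat_smooth_exp p i al be :
    flat_smooth (fun x => flat_exp p (al * x ord0 i + be))
| flat_smoothD psi chi : flat_smooth psi -> flat_smooth chi -> flat_smooth (psi + chi)
| flat_smoothM psi chi : flat_smooth psi -> flat_smooth chi -> flat_smooth (psi * chi).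

Lemma flat_smooth_continuous psi : flat_smooth psi -> continuous psi.
Proof.
elim=> [c|p i al be|chi1 chi2 _ c1 _ c2|chi1 chi2 _ c1 _ c2] x.
- exact: cst_continuous.
- apply: (@continuous_comp _ _ _ (fun x : 'rV[R]_n => al * x ord0 i + be)
    (flat_exp p)); last exact: flat_exp_continuous.
  have cx := @coord_continuous R 1 n ord0 i x.
  exact (cvgD (cvgM (cvg_cst al) cx) (cvg_cst be)).
- exact (cvgD (c1 x) (c2 x)).
- exact (cvgM (c1 x) (c2 x)).
Qed.

Lemma slice_is_derive psi x i v :
  is_derive (x ord0 i) 1 (fun s => psi (set_coord x i s)) v ->
  is_derive x (delta_mx ord0 i) psi v.
Proof.
set t := x ord0 i.
have E : (fun h : R => h^-1 *: (((fun s => psi (set_coord x i s)) \o shift t) (h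
    *: 1) - psi (set_coord x i t))) =
   (fun h : R => h^-1 *: ((psi \o shift x) (h *: delta_mx ord0 i) - psi x)).
  apply/funext => h /=; rewrite [h *: 1]mulr1 set_coord_shift.
  by rewrite /t set_coord_id.
by move=> [dg <-]; split; rewrite /derivable /derive -E.
Qed.

Lemma flat_smooth_derive psi i : flat_smooth psi ->
  exists chi, flat_smooth chi /\ forall x, is_derive x (delta_mx ord0 i) psi (chi x).
Proof.
elim=> [c|p j al be|p1 p2 s1 [c1 [sc1 d1]] s2 [c2 [sc2 d2]]|p1 p2 s1 [c1 [sc1
    d1]] s2 [c2 [sc2 d2]]].
- by exists (cst 0); split=> [|x]; [exact: flat_smooth_cst|exact: is_derive_cst].
- have [->|ji] := eqVneq j i; last first.
    exists (cst 0); split=> [|x]; first exact: flat_smooth_cst.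
    apply: slice_is_derive; under eq_fun do rewrite set_coord_neq//.
    exact: is_derive_cst.
  exists (cst al * (fun x => flat_exp ('X^2 * (p - p^`())) (al * x ord0 i +
      be))); split=> [|x].
    by apply: flat_smoothM; [exact: flat_smooth_cst|exact: flat_smooth_exp].
  apply: slice_is_derive; under eq_fun do rewrite set_coordE.
  have da : is_derive (x ord0 i) 1 (fun s : R => al * s + be) al.
    have := @is_deriveD R R R ( *:%R al \o id ) (cst be) (x ord0 i) 1 _ _
        (is_deriveZ al (is_derive_id _ _)) (is_derive_cst _ _ _).
    by move/is_derive_eq; apply; rewrite addr0 [LHS]mulr1.
  have := is_derive1_comp (is_derive_flat_exp p _) da.
  by move/is_derive_eq; apply; rewrite mulrC.
- exists (c1 + c2); split=> [|x]; first exact: flat_smoothD.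
  exact: is_deriveD (d1 x) (d2 x).
- exists (p1 * c2 + p2 * c1); split=> [|x].
    by apply: flat_smoothD; exact: flat_smoothM.
  exact: is_deriveM (d1 x) (d2 x).
Qed.

Lemma flat_smooth_pds psi s : flat_smooth psi -> flat_smooth (pds s psi).
Proof.
move=> sp; elim: s => //= i s /(flat_smooth_derive i)[chi [schi dchi]].
have -> : pd i (pds s psi) = chi by apply/funext => x; have [_] := dchi x.
by [].
Qed.

Lemma flat_smooth_test psi (U : set 'rV[R]_n) : flat_smooth psi ->
  compact (closure [set x | psi x != 0]) ->
  closure [set x | psi x != 0] `<=` U -> test_function U psi.
Proof.
move=> sp cp cU; split => //.
- by move=> s; apply/flat_smooth_continuous/flat_smooth_pds.
- move=> s i x; have [chi [_ /(_ x)[]]] := flat_smooth_derive i (flat_smooth_pds s sp).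
  by [].
Qed.

Lemma flat_smooth_prod (s : seq 'I_n) (F : 'I_n -> 'rV[R]_n -> R) :
  (forall i, flat_smooth (F i)) -> flat_smooth (fun x => \prod_(i <- s) F i x).
Proof.
move=> sF; elim: s => [|i s IH].
  by under eq_fun do rewrite big_nil; exact: flat_smooth_cst.
under eq_fun do rewrite big_cons.
exact: flat_smoothM.
Qed.

End smooth_functions.

(** * Bumps and distributional derivatives *)

Section bumps.
Context {R : realType} {n : nat}.
Implicit Types (x c e : 'rV[R]_n) (i j : 'I_n) (k : nat).

(** An approximation from below of the indicator of an open box. The shift by -1
    keeps the support at distance 1/(k+1) from the faces, so that it is compact
    in the open box. *)
Definition bump c e k x : R := \prod_j
  (step (k.+1%:R * (x ord0 j - c ord0 j) - 1) *
   step (k.+1%:R * (e ord0 j - x ord0 j) - 1)).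

Lemma flat_smooth_bump c e k : flat_smooth (bump c e k).
Proof.
apply: (@flat_smooth_prod _ _ _ (fun j x => step (k.+1%:R * (x ord0 j - c ord0 j) - 1) *
   step (k.+1%:R * (e ord0 j - x ord0 j) - 1))) => j.
apply: (@flat_smoothM _ _ (fun x => step (k.+1%:R * (x ord0 j - c ord0 j) - 1))
  (fun x => step (k.+1%:R * (e ord0 j - x ord0 j) - 1))).
- have -> : (fun x : 'rV[R]_n => step (k.+1%:R * (x ord0 j - c ord0 j) - 1)) =
    (fun x => flat_exp 1 (k.+1%:R * x ord0 j + (- k.+1%:R * c ord0 j - 1))).
    by apply/funext => x; rewrite /step; congr flat_exp; ring.
  exact: flat_smooth_exp.
- have -> : (fun x : 'rV[R]_n => step (k.+1%:R * (e ord0 j - x ord0 j) - 1)) =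
    (fun x => flat_exp 1 (- k.+1%:R * x ord0 j + (k.+1%:R * e ord0 j - 1))).
    by apply/funext => x; rewrite /step; congr flat_exp; ring.
  exact: flat_smooth_exp.
Qed.

Lemma bump_ge0 c e k x : 0 <= bump c e k x.
Proof. by apply: prodr_ge0 => j _; rewrite mulr_ge0// step_ge0. Qed.

Lemma bump_le1 c e k x : bump c e k x <= 1.
Proof.
apply: prodr_ile1 => j _; rewrite mulr_ge0 ?step_ge0//=.
by rewrite mulr_ile1 ?step_ge0 ?step_le1.
Qed.

Lemma flat_smooth_measurable (psi : 'rV[R]_n -> R) : flat_smooth psi ->
    measurable_fun setT psi.
Proof.
move=> sp; apply: within_continuous_measurable => //.
exact/continuous_subspaceT/flat_smooth_continuous.
Qed.

Lemma bmf_bump c e k : bmf (bump c e k).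
Proof.
split; first exact: (flat_smooth_measurable (flat_smooth_bump c e k)).
by exists 1 => x; rewrite ger0_norm; [exact: bump_le1|exact: bump_ge0].
Qed.

Lemma bump_support c e k x : bump c e k x != 0 ->
  box (\row_j (c ord0 j + k.+1%:R^-1)) (\row_j (e ord0 j - k.+1%:R^-1)) x.
Proof.
move=> /prodf_neq0 h j; have := h j isT; rewrite mulf_eq0 negb_or !mxE => /andP[h1 h2].
have k0 : 0 < k.+1%:R :> R by [].
apply/andP; split; rewrite leNgt; apply/negP => xk.
  move: h1; rewrite step_le0 ?eqxx// subr_le0 mulrC -ler_pdivlMr// mul1r.
  by rewrite lerBlDl ltW.
move: h2; rewrite step_le0 ?eqxx// subr_le0 mulrC -ler_pdivlMr// mul1r.
by rewrite lerBlDl -lerBlDr ltW.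
Qed.

Lemma bump_test c e k U :
  box (\row_j (c ord0 j + k.+1%:R^-1)) (\row_j (e ord0 j - k.+1%:R^-1)) `<=` U ->
  test_function U (bump c e k).
Proof.
set K := box _ _ => KU; have cK : compact K by exact: compact_box.
have sK : closure [set x | bump c e k x != 0] `<=` K.
  have clK : closed K by apply: compact_closed => //; exact: norm_hausdorff.
  have /closure_id KK := clK; rewrite [X in _ `<=` X]KK.
  by apply: closure_subset => x; exact: bump_support.
apply: flat_smooth_test.
- exact: flat_smooth_bump.
- by apply: subclosed_compact cK sK; exact: closed_closure.
- exact: subset_trans KU.
Qed.

Lemma bump_cvg c e x : bump c e k x @[k --> \oo] --> (\1_(obox c e) x : R).
Proof.
rewrite indicE; case: (boolP (x \in _)) => [/set_mem xce|/negP xce].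
  have : \prod_j (step (k.+1%:R * (x ord0 j - c ord0 j) - 1) *
     step (k.+1%:R * (e ord0 j - x ord0 j) - 1)) @[k --> \oo] --> (\prod_(j < n)
         (1 * 1) : R).
    elim: (index_enum _) => [|j s IH].
      by under eq_fun do rewrite big_nil; rewrite big_nil; exact: cvg_cst.
    under eq_fun do rewrite big_cons; rewrite big_cons.
    have := xce j; rewrite /= in_itv/= => /andP[cx xe].
    apply: cvgM IH; apply: cvgM; apply: step_cvg1; rewrite subr_gt0//.
  by under eq_bigr do rewrite mulr1; rewrite big1_eq.
have [j] : exists j, ~ (`]c ord0 j, e ord0 j[%classic (x ord0 j)).
  by apply/existsNP => h; apply: xce; rewrite inE.
rewrite /= in_itv/= => /negP; rewrite negb_and -!leNgt => h.
rewrite (_ : (fun k => bump c e k x) = cst 0); first exact: cvg_cst.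
apply/funext => k; rewrite /bump (bigD1 j)//= [X in X * _](_ : _ = 0) ?mul0r//.
by case/orP: h => h; [rewrite [X in X * _]step_le0 ?mul0r//|rewrite [X in _ *
    X]step_le0 ?mulr0//];
  rewrite subr_le0 (le_trans _ ler01)// mulr_ge0_le0// subr_le0.
Qed.

Lemma bmf_mul_bump_cvg (m : {measure set 'rV[R]_n -> \bar R}) (U : set 'rV[R]_n) g c e :
  measurable U -> (m U < +oo)%E -> bmf g -> obox c e `<=` U ->
  \int[m]_(x in U) (g x * bump c e k x) @[k --> \oo] --> \int[m]_(x in obox c e) g x.
Proof.
move=> mU mUoo bg QU; have mQ := measurable_obox c e.
have bgQ : bmf (g \_ (obox c e)).
  have [mg [M gM]] := bg; apply: bmf_patch => //; first exact: measurable_funTS.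
  by exists M => x _.
have -> : \int[m]_(x in obox c e) g x = \int[m]_(x in U) (g \_ (obox c e)) x.
  by rewrite -Rintegral_mkcondr setIidr.
apply: fine_cvg; rewrite -[X in _ --> X]/((\int[m]_(x in U) (g \_ (obox c e))
    x)%:E) EFin_bmf_int//.
have [mg _] := bg.
apply: (@dominated_cvg _ _ _ _ _ mU _ _ (fun x => `|g x|%:E)).
- move=> k; apply/measurable_EFinP/measurable_funTS.
  by have [] := bmfM bg (bmf_bump c e k).
- move=> x _; apply: cvg_EFin; first by apply: nearW.
  rewrite (_ : fine \o _ = fun k => g x * bump c e k x)//.
  have -> : (g \_ (obox c e)) x = g x * \1_(obox c e) x.
    by rewrite patchE indicE; case: (x \in _); rewrite ?mulr1 ?mulr0.
  exact (cvgM (cvg_cst (g x)) (@bump_cvg c e x)).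
- by [].
- exact/bmf_integrable/bmf_normr.
- move=> k x _; rewrite /= lee_fin normrM ler_piMr//.
  by rewrite ger0_norm; [exact: bump_le1|exact: bump_ge0].
Qed.

End bumps.

Section distributional_derivative.
Context {R : realType} {n : nat}.
Variables (a b : 'rV[R]_n).
Hypothesis ab : forall i, a ord0 i < b ord0 i.
Implicit Types (x c e : 'rV[R]_n) (i : 'I_n) (f gam psi : 'rV[R]_n -> R).
Local Notation mu := (@lebesgue_rV R n).
Local Notation lam := (@lebesgue_measure R).

Lemma within_continuousM (D : set 'rV[R]_n) f psi :
  {within D, continuous f} -> {within D, continuous psi} ->
  {within D, continuous (f * psi)}.
Proof. by move=> cf cp x; exact: cvgM (cf x) (cp x). Qed.

Lemma within_continuousD (D : set 'rV[R]_n) f psi :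
  {within D, continuous f} -> {within D, continuous psi} ->
  {within D, continuous (f + psi)}.
Proof. by move=> cf cp x; exact: cvgD (cf x) (cp x). Qed.

Lemma pd_pairM i f gam psi : pd_pair a b i f gam -> continuous psi ->
  continuous (pd i psi) -> (forall x, derivable psi x (delta_mx ord0 i)) ->
  pd_pair a b i (f * psi) (f * pd i psi + psi * gam).
Proof.
move=> [cf cg df] cp cdp dp; have wp := @continuous_subspaceT _ _ (box a b) _ cp.
have wdp := @continuous_subspaceT _ _ (box a b) _ cdp; split.
- exact: within_continuousM.
- by apply: within_continuousD; exact: within_continuousM.
- move=> y oy; apply: is_deriveM (df y oy) _.
  by split => //; exact: dp.
Qed.

(** The fundamental theorem of calculus on each line in direction i, where [f]
    vanishes at both ends, followed by averaging. *)
Lemma int_box_pd0 i f gam : pd_pair a b i f gam ->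
  (forall x, ~ obox a b x -> f x = 0) ->
  \int[mu]_(x in box a b) (gam \_ (box a b)) x = 0.
Proof.
move=> pg f0; have [cf cg _] := pg; have bg := bmf_patch_box cg.
have c0 : b ord0 i - a ord0 i != 0 by rewrite subr_eq0 gt_eqF.
apply: (mulfI c0); rewrite mulr0 -int_box_edge_int//.
rewrite int_box_obox//; last exact: bmf_edge_int.
transitivity (\int[mu]_(x in obox a b) (0 : R)); last first.
  by rewrite Rintegral_cst ?mul0r//; exact: measurable_obox.
apply: eq_Rintegral => x; rewrite inE => ox.
have bx := obox_sub_box ox.
have [cs ds Ds] := pd_pair_slice ab pg ox.
have := @FTC_prefix _ _ _ _ _ cs ds Ds (b ord0 i).
rewrite lexx (ltW (ab i)) => /(_ isT).
rewrite /edge_int => E; transitivity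
    (f (set_coord x i (b ord0 i)) - f (set_coord x i (a ord0 i))).
  rewrite -E; apply: eq_Rintegral => t; rewrite inE => et.
  by rewrite patchE mem_set//; exact: set_coord_box.
rewrite !f0 ?subrr// => /(_ i); rewrite /= set_coordE in_itv/= ltxx ?andbF//.
Qed.

Lemma distr_by_parts i f gam psi : pd_pair a b i f gam ->
  test_function (obox a b) psi ->
  \int[mu]_(x in obox a b) (f x * pd i psi x) =
  - \int[mu]_(x in obox a b) (gam x * psi x).
Proof.
move=> pg [cp dp _ sp]; have [cf cg _] := pg.
have c0 := cp [::]; have c1 := cp [:: i]; have d0 := dp [::] i.
have psi0 x : ~ obox a b x -> psi x = 0.
  move=> ox; apply/eqP/negPn/negP => px; apply: ox; apply: sp.
  exact: subset_closure.
have pgp := pd_pairM pg c0 c1 d0.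
have := int_box_pd0 pgp.
have z x : ~ obox a b x -> (f * psi) x = 0 by move=> /psi0; rewrite mulrfctE =>
    ->; rewrite mulr0.
move=> /(_ z); rewrite (int_box_obox ab); last by apply: bmf_patch_box; case: pgp.
have w1 : {within box a b, continuous (f * pd i psi)}.
  by apply: within_continuousM => //; exact: continuous_subspaceT.
have w2 : {within box a b, continuous (gam * psi)}.
  by apply: within_continuousM => //; exact: continuous_subspaceT.
have mo := measurable_obox a b.
have E g (h : 'rV[R]_n -> R) : (forall x, obox a b x -> g x = h x) ->
    \int[mu]_(x in obox a b) g x = \int[mu]_(x in obox a b) h x.
  by move=> gh; apply: eq_Rintegral => x; rewrite inE => /gh.
have pE (g : 'rV[R]_n -> R) x : obox a b x -> (g \_ (box a b)) x = g x.
  by move=> /obox_sub_box bx; rewrite patchE mem_set.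
have i1 := bmf_integrable mo (lebesgue_obox_fin ab) (bmf_patch_box w1).
have i2 := bmf_integrable mo (lebesgue_obox_fin ab) (bmf_patch_box w2).
rewrite (E _ (fun x => ((f * pd i psi) \_ (box a b)) x + ((gam * psi) \_ (box a
    b)) x)); last first.
  by move=> x ox; rewrite !pE// addrfctE [psi * gam]mulrC.
rewrite RintegralD// => /eqP; rewrite addr_eq0 => /eqP.
rewrite (E _ (fun x => f x * pd i psi x)); last by move=> x /pE ->.
by rewrite (E ((gam * psi) \_ (box a b)) (fun x => gam x * psi x))// => x /pE ->.
Qed.

End distributional_derivative.

(** * The total variation bounds the integral of the derivative *)

Section total_variation.
Context {R : realType} {n : nat}.
Implicit Types (x c e : 'rV[R]_n) (i : 'I_n) (f g gam psi : 'rV[R]_n -> R).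
Local Notation mu := (@lebesgue_rV R n).

Lemma patch_integrable (U : set 'rV[R]_n) g : measurable U -> (mu U < +oo)%E -> bmf g ->
  mu.-integrable setT (EFin \o (g \_ U)).
Proof.
move=> mU Uoo bg; rewrite -restrict_EFin; apply/(integrable_mkcond _ mU).1.
exact: bmf_integrable.
Qed.

Local Open Scope ereal_scope.

(** The measure with a given density, needed to compare positive measures instead
    of charges. *)
Section density.
Variables (U : set 'rV[R]_n) (g : 'rV[R]_n -> R).
Hypotheses (mU : measurable U) (Uoo : mu U < +oo) (bg : bmf g).
Hypothesis g0 : (forall x, 0 <= g x)%R.

Let density_ge0 (A : set 'rV[R]_n) : 0 <= induced_charge (patch_integrable mU Uoo bg) A.
Proof.
apply: integral_ge0 => x _; rewrite /= lee_fin patchE.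
by case: ifP.
Qed.

Definition density_measure : {measure set 'rV[R]_n -> \bar R} :=
  measure_of_charge _ density_ge0.

Lemma density_measureE A : measurable A ->
  density_measure A = (\int[mu]_(x in A `&` U) g x)%:E.
Proof.
move=> mA; rewrite EFin_bmf_int//; [|exact: measurableI|].
  rewrite integral_mkcondr; apply: eq_integral => x _.
  by rewrite -restrict_EFin.
by apply: le_lt_trans Uoo; rewrite le_measure ?inE//; exact: measurableI.
Qed.

End density.

(** If p - q has density g on open boxes, then the positive measures p + g^- and
    q + g^+ agree on them and hence everywhere. On the set where g is positive
    this gives g^+ <= p, and on its complement g^- <= q. *)
Lemma int_normr_le_variation (U : set 'rV[R]_n) g
    (p q : {finite_measure set 'rV[R]_n -> \bar R}) :
  measurable U -> mu U < +oo -> bmf g ->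
  (forall c e, (fine (p (obox c e `&` U)) - fine (q (obox c e `&` U)) =
     \int[mu]_(x in obox c e `&` U) g x)%R) ->
  (\int[mu]_(x in U) `|g x|)%:E <= p U + q U.
Proof.
move=> mU Uoo bg pqg.
have poo A : measurable A -> p A \is a fin_num by exact: fin_num_measure.
have qoo A : measurable A -> q A \is a fin_num by exact: fin_num_measure.
pose gp x := (2^-1 * (`|g x| + g x))%R; pose gn x := (2^-1 * (`|g x| - g x))%R.
have bgp : bmf gp by apply: bmfM; [exact: bmf_cst|apply: bmfD => //; exact: bmf_normr].
have bgn : bmf gn by apply: bmfM; [exact: bmf_cst|apply: bmfB => //; exact: bmf_normr].
have gp0 x : (0 <= gp x)%R.
  by rewrite /gp mulr_ge0// -lerBlDr sub0r -normrN ler_norm.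
have gn0 x : (0 <= gn x)%R by rewrite /gn mulr_ge0// subr_ge0 ler_norm.
have int A h : measurable A -> A `<=` U -> bmf h -> mu.-integrable A (EFin \o h).
  move=> mA AU bh; apply: bmf_integrable => //.
  by apply: le_lt_trans Uoo; rewrite le_measure ?inE.
pose m1 : {measure set 'rV[R]_n -> \bar R} := measure_add (mrestr p mU)
    (density_measure mU Uoo bgn gn0).
pose m2 : {measure set 'rV[R]_n -> \bar R} := measure_add (mrestr q mU)
    (density_measure mU Uoo bgp gp0).
have m1E A : measurable A -> m1 A = p (A `&` U) + (\int[mu]_(x in A `&` U) gn x)%:E.
  by move=> mA; rewrite [LHS]measure_addE density_measureE.
have m2E A : measurable A -> m2 A = q (A `&` U) + (\int[mu]_(x in A `&` U) gp x)%:E.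
  by move=> mA; rewrite [LHS]measure_addE density_measureE.
have m12 A : measurable A -> m1 A = m2 A.
  apply: obox_measure_unique => c e; have mQ := measurable_obox c e.
    have mQU := measurableI _ _ mQ mU.
    rewrite m1E// m2E// -(fineK (poo _ mQU)) -(fineK (qoo _ mQU)) -!EFinD; congr EFin.
    have := pqg c e; have -> : (\int[mu]_(x in obox c e `&` U) g x =
      \int[mu]_(x in obox c e `&` U) gp x - \int[mu]_(x in obox c e `&` U) gn x)%R.
      rewrite -RintegralB//; [|exact: int..].
      by apply: eq_Rintegral => x _; rewrite /gp /gn; field.
    lra.
  by rewrite m1E// lte_add_pinfty ?ltry// ltey_eq poo//; exact: measurableI.
have mg : measurable_fun setT g by case: bg.
have half (r s : {finite_measure set 'rV[R]_n -> \bar R}) h k (A : set 'rV[R]_n) :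
    measurable A -> bmf h -> bmf k -> (forall x, A x -> k x = 0%R) ->
    (forall x, (0 <= h x)%R) -> (forall x, ~ A x -> h x = 0%R) ->
    r (A `&` U) + (\int[mu]_(x in A `&` U) k x)%:E = s (A `&` U) + (\int[mu]_(x
        in A `&` U) h x)%:E ->
    (\int[mu]_(x in U) h x)%:E <= r U.
  move=> mA bh bk kA h0 hA E.
  have mAU := measurableI _ _ mA mU.
  have <- : (\int[mu]_(x in A `&` U) h x = \int[mu]_(x in U) h x)%R.
    rewrite setIC Rintegral_mkcondr; apply: eq_Rintegral => x _; rewrite patchE.
    by case: ifPn => // /negP xA; rewrite hA// => Ax; apply: xA; rewrite inE.
  apply: (@le_trans _ _ (r (A `&` U))); last by rewrite le_measure ?inE//; exact:
      subIsetr.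
  move: E; rewrite (_ : \int[mu]_(x in A `&` U) k x = 0)%R; last first.
    transitivity (\int[mu]_(x in A `&` U) (0 : R))%R.
      by apply: eq_Rintegral => x; rewrite inE => -[Ax _]; exact: kA.
    by rewrite Rintegral_cst ?mul0r.
  by rewrite adde0 => ->; rewrite leeDr.
have mP : measurable [set x | (0 < g x)%R].
  have := mg measurableT _ (measurable_itv `]0%R, +oo[); rewrite setTI.
  by congr measurable; apply/seteqP; split=> x; rewrite /= in_itv/= andbT.
have -> : (\int[mu]_(x in U) `|g x| = \int[mu]_(x in U) gp x + \int[mu]_(x in U) gn x)%R.
  rewrite -RintegralD//; [|exact: int..].
  by apply: eq_Rintegral => x _; rewrite /gp /gn; field.
rewrite EFinD; apply: leeD.
- apply: (half p q gp gn [set x | (0 < g x)%R]) => //.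
  + by move=> x /= gx; rewrite /gn gtr0_norm// subrr mulr0.
  + by move=> x /= /negP; rewrite -leNgt => gx; rewrite /gp ler0_norm// addNr mulr0.
  + by rewrite -m1E// -m2E// m12.
- apply: (half q p gn gp (~` [set x | (0 < g x)%R])) => //.
  + exact: measurableC.
  + by move=> x /= /negP; rewrite -leNgt => gx; rewrite /gp ler0_norm// addNr mulr0.
  + by move=> x /= /contrapT gx; rewrite /gn gtr0_norm// subrr mulr0.
  + by rewrite -m1E ?m12 ?m2E//; exact: measurableC.
Qed.

Variables (a b : 'rV[R]_n).
Hypothesis ab : forall i, (a ord0 i < b ord0 i)%R.

(** Test the distributional derivative with the bumps of the open box and pass to
    the limit by dominated convergence. *)
Lemma distr_deriv_obox i f gam (nu : {charge set 'rV[R]_n -> \bar R}) P N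
    (nuPN : hahn_decomposition nu P N) c e :
  pd_pair a b i f gam -> is_distr_deriv (box a b)° i f nuPN ->
  (fine (jordan_pos nuPN (obox c e `&` obox a b)) -
   fine (jordan_neg nuPN (obox c e `&` obox a b)) =
     \int[mu]_(x in obox c e `&` obox a b) (gam \_ (box a b)) x)%R.
Proof.
move=> pg; rewrite interior_box => nuf.
rewrite obox_setI; set c' := \row_i _; set e' := \row_i _.
have mo := measurable_obox a b; have mQ := measurable_obox c' e'.
have [cg cg' _] := pg; have bg := bmf_patch_box cg'.
have Qab : obox c' e' `<=` obox a b by rewrite -obox_setI; exact: subIsetr.
have supp k : box (\row_j (c' ord0 j + k.+1%:R^-1)%R) (\row_j (e' ord0 j -
    k.+1%:R^-1)%R) `<=` obox a b.
  move=> x h j; have := h j; rewrite /= !mxE in_itv/=.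
  have k0 : (0 < k.+1%:R^-1 :> R)%R by rewrite invr_gt0.
  move=> /andP[h1 h2]; apply/andP; split.
    apply: lt_le_trans h1; rewrite ltr_pwDr//.
    by rewrite le_max lexx orbT.
  by apply: le_lt_trans h2 _; rewrite ltrBlDr ltr_pwDr// ge_min lexx orbT.
have poo : (jordan_pos nuPN (obox a b) < +oo) by rewrite ltey_eq fin_num_measure.
have qoo : (jordan_neg nuPN (obox a b) < +oo) by rewrite ltey_eq fin_num_measure.
have eqk k : (\int[mu]_(x in obox a b) ((gam \_ (box a b)) x * bump c' e' k x) =
    \int[jordan_pos nuPN]_(x in obox a b) (1 * bump c' e' k x) -
    \int[jordan_neg nuPN]_(x in obox a b) (1 * bump c' e' k x))%R.
  have tk := bump_test (supp k).
  have bb := bmf_bump c' e' k.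
  have := nuf _ tk.
  rewrite -(EFin_bmf_int mo poo bb) -(EFin_bmf_int mo qoo bb) => /(congr1 fine)/= E.
  have := distr_by_parts ab pg tk; rewrite [LHS]E => /oppr_inj h.
  have one (m : {measure set 'rV[R]_n -> \bar R}) :
      (\int[m]_(x in obox a b) (1 * bump c' e' k x) =
       \int[m]_(x in obox a b) bump c' e' k x)%R.
    by apply: eq_Rintegral => x _; rewrite mul1r.
  rewrite !one h; apply: eq_Rintegral => x; rewrite inE => /obox_sub_box bx.
  by rewrite patchE mem_set.
have b1 : bmf (fun _ : 'rV[R]_n => 1%R : R) := bmf_cst _ 1%R.
have L := bmf_mul_bump_cvg mo (lebesgue_obox_fin ab) bg Qab.
have Lp := bmf_mul_bump_cvg mo poo b1 Qab.
have Lq := bmf_mul_bump_cvg mo qoo b1 Qab.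
rewrite !Rintegral_cst// !mul1r in Lp Lq.
have Lpq := @cvgB _ _ _ _ eventually_filter _ _ _ _ Lp Lq.
rewrite -(cvg_lim (@Rhausdorff R) L) -(cvg_lim (@Rhausdorff R) Lpq).
by rewrite (funext eqk).
Qed.

(** The infimum runs over the measures nu that represent the derivative, and the
    bound holds for each of them. *)
Lemma int_normr_le_distr_variation i f gam : pd_pair a b i f gam ->
  (\int[mu]_(x in box a b) `|(gam \_ (box a b)) x|)%:E <=
  distr_variation (box a b)° i f.
Proof.
move=> pg; have [_ cg _] := pg; have bg := bmf_patch_box cg.
apply: le_ereal_inf_tmp => _ [nu [P [N [nuPN [nuf ->]]]]].
rewrite (int_box_obox ab); last exact: bmf_normr.
rewrite interior_box; apply: int_normr_le_variation => //.
- exact: measurable_obox.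
- exact: lebesgue_obox_fin.
- by move=> c e; exact: (distr_deriv_obox c e pg nuf).
Qed.

End total_variation.

(** * The two bounds *)

Section bound.
Context {R : realType} {n : nat}.
Variables (a b : 'rV[R]_n).
Hypothesis ab : forall i, a ord0 i < b ord0 i.
Implicit Types (x : 'rV[R]_n) (i : 'I_n) (f w h gam psi phi : 'rV[R]_n -> R).
Implicit Types (I : {set 'I_n}) (P : 'rV[R]_n -> Prop).
Local Notation mu := (@lebesgue_rV R n).
Local Notation ae_box P := (\forall x \ae lebesgue_box a b, box a b x -> P x).
Local Open Scope ereal_scope.

Lemma lebesgue_box_gt0 m (c e : 'rV[R]_m) : (forall j, (c ord0 j < e ord0 j)%R) ->
  0 < lebesgue_box c e setT.
Proof.
move=> ce; rewrite /lebesgue_box/= /mrestr setTI.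
have /= -> := lebesgue_rV_box ce.
by rewrite lte_fin; apply: prodr_gt0 => j _; rewrite subr_gt0.
Qed.

Lemma ae_box_mu P : ae_box P -> \forall x \ae mu, box a b x -> P x.
Proof.
move=> [N [mN N0 sub]]; exists (N `&` box a b); split => //.
  by apply: measurableI => //; exact: measurable_box.
move=> x /= h; have [bx|bx] := pselect (box a b x); last by exfalso; apply: h.
by split=> //; apply: sub => /= k; apply: h => _; exact: k.
Qed.

Lemma ae_box_Linfty_norm psi : ae_box (fun x => (`|psi x|)%:E <= Linfty_norm a b psi).
Proof.
have := ess_sup_ge (lebesgue_box a b) (abse \o (EFin \o psi)).
apply: filterS => x h _.
rewrite /Linfty_norm unlock /Lnorm lebesgue_box_gt0//.
Qed.

Lemma ess_sup_normr_ge0 m (c e : 'rV[R]_m) (h : 'rV[R]_m -> \bar R) :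
  (forall j, (c ord0 j < e ord0 j)%R) -> (forall y, 0 <= h y) ->
  0 <= ess_sup (lebesgue_box c e) h.
Proof.
move=> ce h0; apply: ess_sup_gee; first exact: lebesgue_box_gt0.
exact: nearW.
Qed.

(** Truncate at the essential supremum norm and extend by 0 outside the box. *)
Lemma Linfty_representative phi : Linfty a b phi ->
  exists2 chi, bmf chi & ae_box (fun x => phi x = chi x).
Proof.
move=> [mphi fphi]; have mb := measurable_box a b.
pose M := fine (Linfty_norm a b phi).
have ME : Linfty_norm a b phi = M%:E.
  rewrite fineK// ge0_fin_numE; first exact: fphi.
  exact: Lnorm_ge0.
pose chi := (fun x => Num.max (- M) (Num.min M (phi x)))%R \_ (box a b).
exists chi.
  apply: bmf_patch => //.
    apply: measurable_maxr => //.
    by apply: measurable_minr.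
  exists `|M|%R => x _; rewrite ler_norml; apply/andP; split.
    by rewrite le_max lerN2 ler_norm.
  by rewrite ge_max ge_min ler_norm/= andbT (le_trans (ler_norm _))// normrN.
apply: filterS (ae_box_Linfty_norm phi) => x + bx => /(_ bx).
rewrite ME lee_fin ler_norml => /andP[phiM Mphi].
by rewrite /chi patchE mem_set// min_r// max_r.
Qed.

(** The weight [w] is the density itself for the remainder term, and the absolute
    value of a partial derivative of the density for the two main terms. *)
Lemma weighted_int_le h w (L : \bar R) : bmf h -> bmf w ->
  (forall x, 0 <= h x)%R -> (forall x, 0 <= w x)%R -> 0 <= L ->
  ae_box (fun x => (h x)%:E <= L) ->
  (\int[mu]_(x in box a b) (h x * w x))%:E <= L * (\int[mu]_(x in box a b) w x)%:E.
Proof.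
move=> bh bw h0 w0 L0 hL; have mb := measurable_box a b.
have fb := lebesgue_box_fin ab.
have [mh _] := bh; have [mw _] := bw.
have mEw : measurable_fun (box a b) (EFin \o w).
  by apply/measurable_EFinP; exact: measurable_funTS.
rewrite !EFin_bmf_int//; last exact: bmfM.
rewrite -ge0_integralZl//; last by move=> x _; rewrite lee_fin.
apply: ae_ge0_le_integral => //.
- by move=> x _; rewrite lee_fin mulr_ge0.
- by apply/measurable_EFinP/measurable_funTS; case: (bmfM bh bw).
- by move=> x _; rewrite mule_ge0// lee_fin.
- exact: measurable_funeM.
- apply: filterS (ae_box_mu hL) => x + bx => /(_ bx) hxL.
  by rewrite EFinM lee_wpmul2r// lee_fin.
Qed.

Lemma distr_variation_ge0 (U : set 'rV[R]_n) i f : 0 <= distr_variation U i f.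
Proof.
apply: le_ereal_inf_tmp => _ [nu [P [N [nuPN [_ ->]]]]].
exact: measure_ge0.
Qed.

Section representative.
Variables (f phi chi : 'rV[R]_n -> R) (I : {set 'I_n}) (k : nat).
Hypotheses (fk : Ck_closure k (box a b) f) (Ik : (#|I| <= k)%N).
Hypotheses (mphi : measurable_fun (box a b) phi) (bchi : bmf chi).
Hypothesis phichi : ae_box (fun x => phi x = chi x).

Let psi := residual a b (enum I) phi.
Let psi' := residual a b (enum I) chi.

Let mpsi : measurable_fun (box a b) psi.
Proof. exact: measurable_residual. Qed.

Let bpsi' : bmf psi'.
Proof. exact: bmf_residual. Qed.

Let psiE : ae_box (fun x => psi x = psi' x).
Proof.
apply: ae_box_residual => //; apply: measurable_funTS; by case: bchi.
Qed.

Let mean0 i : i \in I -> Pi_ a b i psi' = fun=> 0%R.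
Proof. by move=> iI; apply: Pi_residual => //; rewrite mem_enum. Qed.

Lemma residual_mix_bound :
  (`|\int[mu]_(x in box a b) (psi' x * (f \_ (box a b)) x)|)%:E <= B_mix a b f phi I.
Proof.
have [gam [cg Eg]] : exists gam, pds_extension a b (enum I) f gam.
  by apply: pds_extension_ex fk _; rewrite -cardE.
have bg := bmf_patch_box cg.
have sI : (size (enum I) <= k)%N by rewrite -cardE.
have mI i : i \in enum I -> Pi_ a b i psi' = fun=> 0%R.
  by rewrite mem_enum; exact: mean0.
have L0 : 0 <= Lambda_mix a b I psi.
  apply: ess_sup_normr_ge0; first by move=> j; exact: restr_coord_lt.
  by move=> y; apply: integral_ge0 => t _; rewrite lee_fin.
apply: (@le_trans _ _ ((2 ^- #|I| * \int[mu]_(x in box a b)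
    (edge_ints a b (enum I) (fun y => `|psi' y|) x * `|(gam \_ (box a b)) x|))%R%:E)).
  rewrite lee_fin cardE.
  exact: (int_box_antider_le ab fk sI (enum_uniq _) bpsi' mI).
rewrite /B_mix EFinM -muleA lee_wpmul2l ?lee_fin ?invr_ge0 ?exprn_ge0//.
apply: (le_trans (weighted_int_le _ _ _ _ L0 _)).
- exact/bmf_edge_ints/bmf_normr.
- exact: bmf_normr.
- by move=> x; exact: edge_ints_ge0.
- by [].
- exact: ae_box_edge_ints_le.
apply: lee_wpmul2l => //; rewrite (int_box_obox ab); last exact: bmf_normr.
rewrite EFin_bmf_int; [|exact: measurable_obox|exact: lebesgue_obox_fin|exact: bmf_normr].
rewrite interior_box le_eqVlt; apply/orP; left; apply/eqP/eq_integral => x.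
rewrite inE => ox; rewrite Eg// patchE mem_set//.
exact: obox_sub_box.
Qed.

Lemma residual_slice_bound i : (0 < k)%N -> i \in I ->
  (`|\int[mu]_(x in box a b) (psi' x * (f \_ (box a b)) x)|)%:E <=
  (2^-1)%:E * Lambda_sl a b I psi * distr_variation (box a b)° i f.
Proof.
move=> k0 iI; have [gam ig] : exists gam, pds_extension a b [:: i] f gam.
  exact: pds_extension_ex fk _.
have [cg _] := ig; have bg := bmf_patch_box cg.
have f0 : pds_extension a b [::] f f by split => //; case: fk.
have pg := @pds_extension_pair _ _ _ _ _ _ [::] _ _ _ fk k0 f0 ig.
have mi j : j \in [:: i] -> Pi_ a b j psi' = fun=> 0%R.
  by rewrite inE => /eqP ->; exact: mean0.
pose L := ess_sup (lebesgue_box (restr_coord (~: [set i]%SET) a) (restr_coord (~: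
    [set i]%SET) b))
    (fun u => \int[lebesgue_measure]_(t in `[a ord0 i, b ord0 i])
         `|psi (@glue_coord _ _ [set i]%SET u (const_mx t))|%:E).
have L0 : 0 <= L.
  apply: ess_sup_normr_ge0; first by move=> j; exact: restr_coord_lt.
  by move=> y; apply: integral_ge0 => t _; rewrite lee_fin.
have LI : L <= Lambda_sl a b I psi by rewrite /Lambda_sl (bigD1 i)//= le_max lexx.
apply: (@le_trans _ _ ((2^-1 * \int[mu]_(x in box a b)
    (edge_int a b i (fun y => `|psi' y|) x * `|(gam \_ (box a b)) x|))%R%:E)).
  rewrite lee_fin.
  exact: (@int_box_antider_le _ _ _ _ ab _ _ [:: i] _ _ fk k0 isT bpsi' mi ig).
rewrite EFinM -muleA lee_wpmul2l ?lee_fin ?invr_ge0//.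
apply: (@le_trans _ _ (L * (\int[mu]_(x in box a b) `|(gam \_ (box a b)) x|)%:E)).
  apply: weighted_int_le => //.
  - exact/bmf_edge_int/bmf_normr.
  - exact: bmf_normr.
  - by move=> x; exact: (@edge_ints_ge0 _ _ a b [:: i] (fun y => `|psi' y|%R) x).
  - exact: (ae_box_edge_int_le ab mpsi bpsi' psiE).
apply: lee_pmul => //.
  by rewrite lee_fin; apply: Rintegral_ge0.
exact: int_normr_le_distr_variation.
Qed.

(** The slice bound holds for each i in I; the total variation appears after
    averaging it over I. *)
Lemma residual_TV_bound : (0 < k)%N -> (0 < #|I|)%N ->
  (`|\int[mu]_(x in box a b) (psi' x * (f \_ (box a b)) x)|)%:E <= B_TV a b f phi I.
Proof.
move=> k0 I0; set E := (`|_|)%:E.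
have I0' : (0 < #|I|%:R :> R)%R by rewrite ltr0n.
have -> : B_TV a b f phi I = (#|I|%:R^-1)%:E *
    \sum_(i in I) ((2^-1)%:E * Lambda_sl a b I psi * distr_variation (box a b)° i f).
  rewrite -ge0_sume_distrr; last by move=> i _; exact: distr_variation_ge0.
  by rewrite /B_TV /TV_ invfM mulrC EFinM !muleA.
have -> : E = (#|I|%:R^-1)%:E * \sum_(i in I) E.
  rewrite sumEFin sumr_const -EFinM; congr EFin.
  by rewrite -[X in _ = (_ * X)%R]mulr_natl mulKf// gt_eqF.
apply: lee_wpmul2l; first by rewrite lee_fin invr_ge0 ltW.
by apply: lee_sum => i iI; exact: residual_slice_bound.
Qed.

End representative.

(** Split [phi] into its residual part and the rest: the density integrates the
    rest to at most its essential supremum, and the residual is orthogonal to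
    functions that do not depend on one of the coordinates of I. *)
Lemma expectation_le_delta_plus f phi I : Ck_closure n (box a b) f ->
  is_density a b f -> Linfty a b phi -> (0 < n)%N -> (0 < #|I|)%N ->
  `|expectation_f a b f phi| <=
  Delta_ a b phi I + mine (B_TV a b f phi I) (B_mix a b f phi I).
Proof.
move=> fk [f0 _ f1] phiL n0 I0; have [mphi _] := phiL.
have [chi bchi E] := Linfty_representative phiL.
have mb := measurable_box a b; have fb := lebesgue_box_fin ab.
have bf : bmf (f \_ (box a b)) by case: fk => /bmf_patch_box.
have fE x : box a b x -> (f \_ (box a b)) x = f x by move=> bx; rewrite patchE mem_set.
have mf : measurable_fun (box a b) f.
  by apply: within_continuous_measurable => //; case: fk.
have mchi : measurable_fun (box a b) chi by apply: measurable_funTS; case: bchi.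
set psi' := residual a b (enum I) chi.
have bpsi' : bmf psi' by exact: bmf_residual.
have In : (#|I| <= n)%N by rewrite -[X in (_ <= X)%N]card_ord max_card.
have -> : expectation_f a b f phi =
    (\int[mu]_(x in box a b) (chi x * (f \_ (box a b)) x))%:E.
  rewrite EFin_bmf_int//; last exact: bmfM.
  apply: ae_eq_integral => //.
  - by apply/measurable_EFinP; exact: measurable_funM.
  - by apply/measurable_EFinP; apply: measurable_funTS; case: (bmfM bchi bf).
  - by apply: filterS (ae_box_mu E) => x + bx => /(_ bx) ->; rewrite fE.
have -> : (\int[mu]_(x in box a b) (chi x * (f \_ (box a b)) x) =
    \int[mu]_(x in box a b) ((chi x - psi' x) * (f \_ (box a b)) x) +
    \int[mu]_(x in box a b) (psi' x * (f \_ (box a b)) x))%R.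
  rewrite -RintegralD//; last 2 first.
  - by apply/bmf_integrable => //; apply: bmfM => //; exact: bmfB.
  - by apply/bmf_integrable => //; exact: bmfM.
  by apply: eq_Rintegral => x _; rewrite -mulrDl subrK.
rewrite abse_EFin.
apply: (@le_trans _ _ (`|\int[mu]_(x in box a b) ((chi x - psi' x) * (f \_ (box a
    b)) x)|%:E +
   `|\int[mu]_(x in box a b) (psi' x * (f \_ (box a b)) x)|%:E)).
  by rewrite -EFinD lee_fin ler_normD.
apply: leeD; last first.
  rewrite le_min; apply/andP; split.
  - exact: (residual_TV_bound fk mphi bchi E).
  - exact: (residual_mix_bound fk In mphi bchi E).
have D0 : 0 <= Delta_ a b phi I by exact: Lnorm_ge0.
apply: (@le_trans _ _ ((\int[mu]_(x in box a b) (`|chi x - psi' x| * (f \_ (box a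
    b)) x))%:E)).
  rewrite lee_fin (le_trans (le_normr_Rintegral _ _))//.
    by apply/bmf_integrable => //; apply: bmfM => //; exact: bmfB.
  rewrite le_eqVlt; apply/orP; left; apply/eqP/eq_Rintegral => x; rewrite inE => bx.
  by rewrite normrM fE// [X in (_ * X)%R]ger0_norm// f0.
rewrite -[leRHS]mule1 -f1.
have -> : \int[mu]_(x in box a b) (f x)%:E = (\int[mu]_(x in box a b) (f \_ (box
    a b)) x)%:E.
  rewrite EFin_bmf_int//; apply: eq_integral => x; rewrite inE => bx.
  by rewrite fE.
apply: weighted_int_le => //.
- by apply/bmf_normr/bmfB.
- by move=> x; rewrite patchE; case: ifPn => // /set_mem/f0.
- apply: filterS3 E (ae_box_residual ab (enum I) mphi mchi E)
    (ae_box_Linfty_norm (R_ a b I phi)) => x.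
  move=> + + + bx => /(_ bx) E1 /(_ bx) E2 /(_ bx).
  by rewrite /R_ /P_ -/(residual a b (enum I) phi) /= E1 E2.
Qed.

End bound.

Theorem corollary2p17 (R : realType) (d : nat) (d_gt0 : (0 < d)%N)
    (a b : 'rV[R]_d) (ab : forall i, a ord0 i < b ord0 i)
    (f phi : 'rV[R]_d -> R)
    (fCd : Ck_closure d (box a b) f) (f_density : is_density a b f)
    (phi_Linfty : Linfty a b phi) :
  (`|expectation_f a b f phi| <=
   \big[mine/+oo]_(I : {set 'I_d} | I != finset.set0)
     (Delta_ a b phi I + mine (B_TV a b f phi I) (B_mix a b f phi I)))%E.
Proof.
apply: le_bigmin => [|I I0]; first exact: leey.
by apply: expectation_le_delta_plus; rewrite ?card_gt0.
Qed.
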